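(* Let $G$ and $H$ be countable discrete groups and $\varphi:G\to H$ a coarse equivalence. (i) For every commutative ring $R$ with unit and every $R$-module $W$, $\varphi$ induces isomorphisms (a) $H_*(G,C(G,W))\cong H_*(H,C(H,W))$, (b) $H_*(G,C_f(G,W))\cong H_*(H,C_f(H,W))$ and $H^*(G,C_f(G,W))\cong H^*(H,C_f(H,W))$, (c) $H^*(H,RH\otimes_RW)\cong H^*(G,RG\otimes_RW)$. (ii) Let $R=\mathbb R$ or $R=\mathbb C$ and $W=R$. (1) For all $0<p\le\infty$, $\varphi$ induces isomorphisms $H_*(G,\ell^p(G,W))\cong H_*(H,\ell^p(H,W))$, $H^*(H,\ell^p(H,W))\cong H^*(G,\ell^p(G,W))$, $\bar H_*(G,\ell^p(G,W))\cong\bar H_*(H,\ell^p(H,W))$, $\bar H^*(H,\ell^p(H,W))\cong\bar H^*(G,\ell^p(G,W))$. (2) $\varphi$ induces isomorphisms $H_*(G,c_0(G,W))\cong H_*(H,c_0(H,W))$, $H^*(H,c_0(H,W))\cong H^*(G,c_0(G,W))$, $\bar H_*(G,c_0(G,W))\cong\bar H_*(H,c_0(H,W))$, $\bar H^*(H,c_0(H,W))\cong\bar H^*(G,c_0(G,W))$. (3) Let $G$ and $H$ be finitely generated discrete groups. Then, for all $s\in\mathbb R\cup\{\infty\}$ and $1\le p\le\infty$, $\varphi$ induces isomorphisms $H_*(G,H^{s,p}(G,W))\cong H_*(H,H^{s,p}(H,W))$, $H^*(H,H^{s,p}(H,W))\cong H^*(G,H^{s,p}(G,W))$, $\bar H_*(G,H^{s,p}(G,W))\cong\bar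 H_*(H,H^{s,p}(H,W))$, $\bar H^*(H,H^{s,p}(H,W))\cong\bar H^*(G,H^{s,p}(G,W))$.
   Context: $\varphi:G\to H$ is a coarse map if it has finite point preimages and for every $S\subseteq G\times G$ with $\{st^{-1}:(s,t)\in S\}$ finite, $\{\varphi(s)\varphi(t)^{-1}:(s,t)\in S\}$ is finite. $\varphi\sim\phi$ means $\{\varphi(x)\phi(x)^{-1}:x\in G\}$ is finite. A coarse map $\varphi$ is a coarse equivalence if there is a coarse map $\psi:H\to G$ with $\psi\circ\varphi\sim\mathrm{id}_G$, $\varphi\circ\psi\sim\mathrm{id}_H$. $C(G,W)$ is the $RG$-module of all functions $G\to W$ with $(g.f)(x)=f(g^{-1}x)$; the following are $RG$-submodules: $C_f(G,W)$, the functions taking only finitely many values; $RG\otimes_RW$, identified with the finitely supported functions; for $W=R\in\{\mathbb R,\mathbb C\}$: $c_0(G,W)=\{f:\lim_{x\to\infty}|f(x)|=0\}$ with the sup norm; $\ell^p(G,W)=\{f:\sum_x|f(x)|^p<\infty\}$ (bounded functions if $p=\infty$) with its usual (quasi-)norm topology; for $G$ finitely generated with right-invariant word length $\ell$ of a finite symmetric generating set, $H^{s,p}(G,W)=\{f:f\cdot(1+\ell)^s\in\ell^p(G,W)\}$ for $s\in\mathbb R$, with norm $\|f\|_{s,p}=\|f\cdot(1+\ell)^s\|_{\ell^p}$, and $H^{\infty,p}(G,W)=\bigcap_{s\in\mathbb R}H^{s,p}(G,W)$ with the projective limit topology. For such a coefficient module $L=L(G)$, let $D_n(L)$ be the set of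 functions $f:G\times G^n\to W$ with $f(\cdot,\vec g)\in L$ for all $\vec g\in G^n$ and $f(\cdot,\vec g)\neq0$ for only finitely many $\vec g$, and $D^n(L)$ the same without the finiteness condition. With $\delta_n^{(0)}(x,g_1,\dots,g_n)=(g_1^{-1}x,g_2,\dots,g_n)$, $\delta_n^{(i)}(x,g_1,\dots,g_n)=(x,g_1,\dots,g_ig_{i+1},\dots,g_n)$ ($1\le i\le n-1$), $\delta_n^{(n)}(x,g_1,\dots,g_n)=(x,g_1,\dots,g_{n-1})$, the differentials are $d_n=\sum_{i=0}^n(-1)^i(\delta_n^{(i)})_*$ (summation over fibres) and $d^n=\sum_{i=0}^{n+1}(-1)^i(\delta_{n+1}^{(i)})^*$ (composition). These are canonically the bar complexes, so they compute $H_*(G,L)$ and $H^*(G,L)$. Both $D_n(L)$ and $D^n(L)$ carry the topology of pointwise convergence: $f_i\to f$ if and only if $f_i(\cdot,\vec g)\to f(\cdot,\vec g)$ in $L$ for all $\vec g\in G^n$. Reduced (co)homology is $\bar H_n(G,L)=\ker(d_n)/\overline{\mathrm{im}(d_{n+1})}$, $\bar H^n(G,L)=\ker(d^n)/\overline{\mathrm{im}(d^{n-1})}$. ''Induced by $\varphi$'' means induced by the maps $(\varphi^n)_*:D_n(L(G))\to D_n(L(H))$ and $(\varphi^n)^*:D^n(L(H))\to D^n(L(G))$, where $\varphi^n(x,g_1,\dots,g_n)=(\varphi(x_0),\varphi(x_0)\varphi(x_1)^{-1},\dots,\varphi(x_{n-1})\varphi(x_n)^{-1})$ with $x_0=x$,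 $x_i=g_i^{-1}x_{i-1}$. *)

(* Defs.v *)
From HB Require Import structures.
From mathcomp Require Import all_boot all_order all_algebra.
From mathcomp Require Import all_classical reals ereal topology normedtype.
From mathcomp Require Import sequences exp esum complex.

Set Implicit Arguments.
Unset Strict Implicit.
Unset Printing Implicit Defensive.

Import Order.TTheory GRing.Theory Num.Theory.

Local Open Scope classical_set_scope.
Local Open Scope ring_scope.
Local Open Scope quotient_scope.

Record submodule (R : pzRingType) (V : lmodType R) := Submodule {
  submod_set :> set V;
  submod0 : submod_set 0;
  submodP : forall a u v,
    submod_set u -> submod_set v -> submod_set (a *: u + v) }.

Section SubmoduleType.
Variables (R : pzRingType) (V : lmodType R) (S : submodule V).

Definition submod_pred : {pred V} := fun x => x \in (S : set V).

Lemma submod_pred_closed : GRing.submod_closed submod_pred.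
Proof.
split=> [|a u v]; rewrite /submod_pred ?unfold_in; first exact/mem_set/submod0.
by move=> /set_mem Su /set_mem Sv; exact/mem_set/submodP.
Qed.

HB.instance Definition _ :=
  GRing.isSubmodClosed.Build R V submod_pred submod_pred_closed.

Record submod_type := SubmodType {
  submod_val :> V;
  submod_valP : submod_val \in submod_pred }.

HB.instance Definition _ := [isSub for submod_val].
HB.instance Definition _ := [Choice of submod_type by <:].
HB.instance Definition _ := [SubChoice_isSubLmodule of submod_type by <:].

Lemma submodE (x : submod_type) : submod_set S (submod_val x).
Proof. exact/set_mem/(submod_valP x). Qed.

Lemma submod_val0 : submod_val 0 = 0. Proof. exact: (raddf0 val). Qed.
Lemma submod_valD x y : submod_val (x + y) = submod_val x + submod_val y.
Proof. exact: (raddfD val). Qed.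
Lemma submod_valB x y : submod_val (x - y) = submod_val x - submod_val y.
Proof. exact: (raddfB val). Qed.
Lemma submod_valZ a x : submod_val (a *: x) = a *: submod_val x.
Proof. by []. Qed.

Definition mk_submod x (Sx : submod_set S x) : submod_type :=
  SubmodType (mem_set Sx).

End SubmoduleType.

(* [subquotient Z B] is Z / (Z `&` B), that is Z / B when B `<=` Z, as is the
   case for (closures of) boundaries inside cycles. *)
Section Subquotient.
Variables (R : pzRingType) (V : lmodType R) (Z B : submodule V).

Definition trace_pred : {pred submod_type Z} :=
  fun z => submod_val z \in submod_pred B.

Lemma trace_pred_closed : GRing.submod_closed trace_pred.
Proof.
have [B0 BP] := submod_pred_closed B.
split=> [|a u v]; first by rewrite /trace_pred unfold_in submod_val0.
rewrite /trace_pred !unfold_in submod_valD submod_valZ => ? ?; exact: BP.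
Qed.

HB.instance Definition _ :=
  GRing.isSubmodClosed.Build R (submod_type Z) trace_pred trace_pred_closed.

Definition subquotient := {ideal_quot trace_pred}.
HB.instance Definition _ := GRing.Zmodule.on subquotient.

Definition subq_class (z : submod_type Z) : subquotient := \pi_({ideal_quot trace_pred}) z.

Lemma subq_class_surj (x : subquotient) : exists z, x = subq_class z.
Proof. by exists (repr (x : {ideal_quot trace_pred})); rewrite /subq_class reprK. Qed.

Lemma subq_classE (z z' : submod_type Z) :
  subq_class z = subq_class z' <-> submod_set B (submod_val z - submod_val z').
Proof.
rewrite /subq_class; split.
  by move/eqP; rewrite -Quotient.idealrBE => /set_mem; rewrite submod_valB.
by move=> h; apply/eqP; rewrite -Quotient.idealrBE; apply/mem_set; rewrite submod_valB.
Qed.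

Lemma subq_classD z z' : subq_class (z + z') = subq_class z + subq_class z'.
Proof. by rewrite /subq_class piE. Qed.

Definition subq_scale (a : R) (x : subquotient) : subquotient :=
  subq_class (a *: repr (x : {ideal_quot trace_pred})).

Lemma subq_scaleE a z : subq_scale a (subq_class z) = subq_class (a *: z).
Proof.
apply/subq_classE; rewrite !submod_valZ -scalerBr.
rewrite -[X in submod_set B X]addr0; apply: submodP; last exact: submod0.
by apply/subq_classE; rewrite {1}/subq_class reprK.
Qed.

Let scaleA a b x : subq_scale a (subq_scale b x) = subq_scale (a * b) x.
Proof. by have [z ->] := subq_class_surj x; rewrite !subq_scaleE scalerA. Qed.
Let scale1 : left_id 1 subq_scale.
Proof. by move=> x; have [z ->] := subq_class_surj x; rewrite !subq_scaleE scale1r. Qed.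
Let scaleDr : right_distributive subq_scale +%R.
Proof.
move=> a x y; have [z ->] := subq_class_surj x; have [t ->] := subq_class_surj y.
by rewrite -subq_classD !subq_scaleE scalerDr subq_classD.
Qed.
Let scaleDl x : {morph subq_scale^~ x : a b / a + b}.
Proof.
move=> a b; have [z ->] := subq_class_surj x.
by rewrite !subq_scaleE scalerDl subq_classD.
Qed.

HB.instance Definition _ := GRing.Zmodule_isLmodule.Build R subquotient
  scaleA scale1 scaleDr scaleDl.

Lemma subq_class_is_linear : linear subq_class.
Proof. by move=> a u v; rewrite subq_classD -subq_scaleE. Qed.

HB.instance Definition _ :=
  GRing.isLinear.Build R (submod_type Z) subquotient _ subq_class subq_class_is_linear.

End Subquotient.

Section Simplices.
Variable G : groupType.

(* [face i] is delta_{n+1}^{(i)} : G x G^{n+1} -> G x G^n.  The entry j of the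
   tuple (counted from 0) is g_{j+1}, g_i g_{i+1} or g_{j+2} according to
   whether j + 1 < i, j + 1 = i or j + 1 > i; this covers i = 0 and i = n+1. *)
Definition face n (i : 'I_n.+2) (xg : G * n.+1.-tuple G) : G * n.-tuple G :=
  let: (x, g) := xg in
  ((if (i : nat) == 0%N then (thead g)^-1 * x else x)%g,
   [tuple (let a := tnth g (widen_ord (leqnSn n) j) in
           let b := tnth g (lift ord0 j) in
           if (j.+1 < i)%N then a
           else if j.+1 == i :> nat then (a * b)%g else b) | j < n]).

(* x_0 = x and x_i = g_i^-1 x_{i-1}. *)
Definition vertex n (x : G) (g : n.-tuple G) (i : nat) : G :=
  foldl (fun y h => h^-1 * y)%g x (take i g).

Definition face_shift n (i : 'I_n.+2) (g : n.+1.-tuple G) : G :=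
  if (i : nat) == 0%N then (thead g)^-1%g else 1%g.

Definition face_tuple n (i : 'I_n.+2) (g : n.+1.-tuple G) : n.-tuple G :=
  (face i (1%g, g)).2.

Lemma faceE n (i : 'I_n.+2) x g :
  face i (x, g) = (face_shift i g * x, face_tuple i g)%g.
Proof.
by rewrite /face_tuple /face_shift /face /=; case: ifP => //; rewrite mul1g.
Qed.

End Simplices.
Arguments face : simpl never.

Definition simplex_map (G H : groupType) (phi : G -> H) n
    (xg : G * n.-tuple G) : H * n.-tuple H :=
  let: (x, g) := xg in
  (phi x, [tuple (phi (vertex x g i) * (phi (vertex x g i.+1))^-1)%g | i < n]).

(* The sum is over the finitely many points of the fibre where f is nonzero;
   for f in D_n(L) and h a face map or a [simplex_map] of a coarse map there
   are indeed finitely many of them. *)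
Definition pushforward (S T : choiceType) (V : nmodType) (h : S -> T)
    (f : S -> V) : T -> V :=
  fun y => \sum_(x \in h @^-1` [set y]) f x.

Section Coefficients.
Variables (R : comPzRingType) (W : lmodType R) (G : groupType).

Definition translate (g : G) (f : G -> W) : G -> W := fun x => f (g^-1 * x)%g.

(* RG-submodules of C(G, W) *)
Record coefficients := Coefficients {
  coef_submod :> submodule ((G -> W) : lmodType R);
  coef_translate : forall g f,
    submod_set coef_submod f -> submod_set coef_submod (translate g f) }.

End Coefficients.

Section Chains.
Variables (R : comPzRingType) (W : lmodType R) (G : groupType).
Variable L : coefficients W G.
Implicit Types n : nat.

Local Notation inL := (submod_set (coef_submod L)).

Definition slice n (c : G * n.-tuple G -> W) (g : n.-tuple G) : G -> W :=
  fun x => c (x, g).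

(* [chain_set n] is D_n(L) and [cochain_set n] is D^n(L). *)
Definition chain_set n : set (G * n.-tuple G -> W) :=
  [set c | (forall g, inL (slice c g)) /\ finite_set [set g | slice c g <> 0]].

Definition cochain_set n : set (G * n.-tuple G -> W) :=
  [set c | forall g, inL (slice c g)].

Lemma coef_sum (I : Type) (r : seq I) (P : pred I) (F : I -> G -> W) :
  (forall i, P i -> inL (F i)) -> inL (\sum_(i <- r | P i) F i).
Proof.
move=> FL; elim/big_ind: _ => //; first exact: submod0.
by move=> u v Lu Lv; rewrite -[u]scale1r; exact: submodP.
Qed.

Lemma coefZ a f : inL f -> inL (a *: f).
Proof. by move=> Lf; rewrite -[_ *: _]addr0; apply: submodP => //; exact: submod0. Qed.

Lemma chain_set0 n : @chain_set n 0.
Proof.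
split=> [g|]; first exact: submod0.
rewrite (_ : [set g | _] = set0) //.
by apply/seteqP; split => // g; apply.
Qed.

Lemma chain_setP n a (u v : G * n.-tuple G -> W) : chain_set u -> chain_set v -> chain_set (a *: u + v).
Proof.
move=> [Lu fu] [Lv fv]; split=> [g|]; first exact: (submodP a (Lu g) (Lv g)).
apply: (@sub_finite_set _ _ ([set g | slice u g <> 0] `|` [set g | slice v g <> 0])).
  move=> g /= uvg; apply: contrapT => /not_orP[/contrapT u0 /contrapT v0].
  apply: uvg; rewrite (_ : slice _ g = a *: slice u g + slice v g) //.
  by rewrite u0 v0 scaler0 addr0.
by rewrite finite_setU.
Qed.

Definition chain_submod n : submodule ((G * n.-tuple G -> W) : lmodType R) :=
  Submodule (chain_set0 n) (@chain_setP n).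

Definition chains n := submod_type (chain_submod n).

Lemma cochain_setP n a (u v : G * n.-tuple G -> W) :
  cochain_set u -> cochain_set v -> cochain_set (a *: u + v).
Proof. by move=> Lu Lv g; exact: (submodP a (Lu g) (Lv g)). Qed.

Definition cochain_submod n : submodule ((G * n.-tuple G -> W) : lmodType R) :=
  @Submodule _ _ (@cochain_set n) (fun g => submod0 L) (@cochain_setP n).

Definition cochains n := submod_type (cochain_submod n).

Definition boundary_fun n (c : G * n.+1.-tuple G -> W) : G * n.-tuple G -> W :=
  \sum_(i < n.+2) (-1) ^+ i *: pushforward (face i) c.

Definition coboundary_fun n (c : G * n.-tuple G -> W) : G * n.+1.-tuple G -> W :=
  \sum_(i < n.+2) (-1) ^+ i *: (c \o face i).

Lemma pushforward_faceE n (i : 'I_n.+2) (c : G * n.+1.-tuple G -> W)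
    (r : seq (n.+1.-tuple G)) h x : uniq r ->
  (forall g, g \notin r -> slice c g = 0) ->
  pushforward (face i) c (x, h) =
    \sum_(g <- r | face_tuple i g == h) translate (face_shift i g) (slice c g) x.
Proof.
move=> ur rc; rewrite bigfs //; last by move=> g _ /rc c0; rewrite /translate c0.
rewrite /pushforward.
rewrite (reindex_fsbig (fun g => ((face_shift i g)^-1 * x, g)%g)
  [set g | face_tuple i g == h]) //.
split.
- by move=> g /= /eqP <-; rewrite faceE mulVKg.
- by move=> g g' _ _ [].
- move=> [y g] /=; rewrite faceE => -[<- <-]; exists g => //=.
  by rewrite mulKg.
Qed.

Lemma chain_support n (c : G * n.-tuple G -> W) : chain_set c ->
  exists2 r : seq (n.-tuple G), uniq r & forall g, g \notin r -> slice c g = 0.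
Proof.
move=> [_ fc]; exists (finmap.enum_fset (fset_set [set g | slice c g <> 0])) => [|g]; first exact: finmap.fset_uniq.
by rewrite in_fset_set // notin_setE /= => /contrapT.
Qed.

Lemma pushforward_face_chain n (i : 'I_n.+2) (c : G * n.+1.-tuple G -> W) : chain_set c ->
  chain_set (pushforward (face i) c).
Proof.
move=> cc; have [r ur rc] := chain_support cc; case: cc => Lc _.
have sE h : slice (pushforward (face i) c) h =
    \sum_(g <- r | face_tuple i g == h) translate (face_shift i g) (slice c g).
  by apply/funext => x; rewrite /slice (pushforward_faceE _ _ _ ur rc) fct_sumE.
split=> [h|]; first by rewrite sE; apply: coef_sum => g _; exact: coef_translate.
apply: (@sub_finite_set _ _ [set` [seq face_tuple i g | g <- r]]) => // h /= h0.
apply: contrapT => /negP hr; apply: h0; rewrite sE big1_seq // => g /andP[/eqP gh gr].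
by move: hr; rewrite -gh map_f.
Qed.

Lemma boundary_chain n (c : G * n.+1.-tuple G -> W) : chain_set c -> chain_set (boundary_fun c).
Proof.
move=> cc; rewrite /boundary_fun; elim/big_ind: _ => [|u v|i _].
- exact: chain_set0.
- by rewrite -{2}[u]scale1r; exact: chain_setP.
- rewrite -[X in chain_set X]addr0; apply: chain_setP; last exact: chain_set0.
  exact: pushforward_face_chain.
Qed.

Lemma pushforward_faceP n (i : 'I_n.+2) a (u v : G * n.+1.-tuple G -> W) :
  chain_set u -> chain_set v ->
  pushforward (face i) (a *: u + v) =
    a *: pushforward (face i) u + pushforward (face i) v.
Proof.
move=> cu cv; apply/funext => -[x h].
have [r ur ru] := chain_support cu; have [s us sv] := chain_support cv.
pose t := undup (r ++ s); have ut : uniq t by exact: undup_uniq.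
have tu g : g \notin t -> slice u g = 0.
  by rewrite mem_undup mem_cat negb_or => /andP[/ru].
have tv g : g \notin t -> slice v g = 0.
  by rewrite mem_undup mem_cat negb_or => /andP[_ /sv].
have tuv g : g \notin t -> slice (a *: u + v) g = 0.
  move=> gt; rewrite (_ : slice _ g = a *: slice u g + slice v g) //.
  by rewrite tu // tv // scaler0 addr0.
rewrite (pushforward_faceE _ _ _ ut tuv).
rewrite -[RHS]/(a *: (pushforward (face i) u (x, h)) + pushforward (face i) v (x, h)).
rewrite (pushforward_faceE _ _ _ ut tu) (pushforward_faceE _ _ _ ut tv).
by rewrite scaler_sumr -big_split.
Qed.

(* d_{n+1} : D_{n+1}(L) -> D_n(L) *)
Definition boundary n (c : chains n.+1) : chains n :=
  @mk_submod _ _ (chain_submod n) _ (boundary_chain (submodE c)).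

Lemma boundary_is_linear n : linear (@boundary n).
Proof.
move=> a u v; apply: val_inj.
rewrite -[LHS]/(boundary_fun (a *: submod_val u + submod_val v)).
rewrite -[RHS]/(a *: boundary_fun (submod_val u) + boundary_fun (submod_val v)).
rewrite /boundary_fun.
rewrite scaler_sumr -big_split; apply: eq_bigr => i _ /=.
by rewrite (pushforward_faceP i a (submodE u) (submodE v)) scalerDr !scalerA mulrC.
Qed.

HB.instance Definition _ n :=
  GRing.isLinear.Build R (chains n.+1) (chains n) _ (@boundary n)
    (@boundary_is_linear n).

Lemma coboundary_cochain n (c : G * n.-tuple G -> W) : cochain_set c -> cochain_set (coboundary_fun c).
Proof.
move=> Lc g.
rewrite (_ : slice _ g = \sum_(i < n.+2) (-1) ^+ i *:
    translate (face_shift i g)^-1 (slice c (face_tuple i g))).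
  by apply: coef_sum => i _; apply: coefZ; exact: coef_translate.
apply/funext => x; rewrite /slice /coboundary_fun !fct_sumE.
apply: eq_bigr => i _.
rewrite -[LHS]/((-1) ^+ i *: (c (face i (x, g)))).
by rewrite faceE -[RHS]/((-1) ^+ i *: (c (_, _))) invgK.
Qed.

(* d^n : D^n(L) -> D^{n+1}(L) *)
Definition coboundary n (c : cochains n) : cochains n.+1 :=
  @mk_submod _ _ (cochain_submod n.+1) _ (coboundary_cochain (submodE c)).

Lemma coboundary_is_linear n : linear (@coboundary n).
Proof.
move=> a u v; apply: val_inj.
rewrite -[LHS]/(coboundary_fun (a *: submod_val u + submod_val v)).
rewrite -[RHS]/(a *: coboundary_fun (submod_val u) + coboundary_fun (submod_val v)).
rewrite /coboundary_fun.
rewrite scaler_sumr -big_split; apply: eq_bigr => i _ /=.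
apply/funext => y.
rewrite -[LHS]/((-1) ^+ i *: (a *: submod_val u (face i y) + submod_val v (face i y))).
by rewrite scalerDr scalerA mulrC -scalerA.
Qed.

HB.instance Definition _ n :=
  GRing.isLinear.Build R (cochains n) (cochains n.+1) _ (@coboundary n)
    (@coboundary_is_linear n).

End Chains.

Section KernelImage.
Variables (R : pzRingType) (U V : lmodType R) (f : {linear U -> V}).

Lemma kernel0 : [set u | f u = 0] 0.
Proof. exact: linear0. Qed.

Lemma kernelP a u v :
  [set u | f u = 0] u -> [set u | f u = 0] v -> [set u | f u = 0] (a *: u + v).
Proof. by rewrite /= linearP => -> ->; rewrite scaler0 addr0. Qed.

Definition kernel : submodule U := Submodule kernel0 kernelP.

Lemma image0 : range f 0.
Proof. by exists 0 => //; exact: linear0. Qed.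

Lemma imageP a u v : range f u -> range f v -> range f (a *: u + v).
Proof. by move=> [x _ <-] [y _ <-]; exists (a *: x + y); rewrite ?linearP. Qed.

Definition image_submod : submodule V := Submodule image0 imageP.

Definition full_submod : submodule V :=
  @Submodule _ _ setT I (fun _ _ _ _ _ => I).

Lemma zero_submodP a (u v : V) : [set 0] u -> [set 0] v -> [set 0] (a *: u + v).
Proof. by move=> -> -> /=; rewrite scaler0 addr0. Qed.

Definition zero_submod : submodule V :=
  @Submodule _ _ [set 0] erefl zero_submodP.

End KernelImage.
Arguments full_submod {R} V.
Arguments zero_submod {R} V.

Section Homology.
Variables (R : comPzRingType) (W : lmodType R) (G : groupType).
Variable L : coefficients W G.

(* d_0 and d^{-1} are zero. *)
Definition cycles n : submodule (chains L n) :=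
  if n is m.+1 then kernel (@boundary _ _ _ L m) else full_submod (chains L 0).

Definition boundaries n : submodule (chains L n) := image_submod (@boundary _ _ _ L n).

Definition cocycles n : submodule (cochains L n) := kernel (@coboundary _ _ _ L n).

Definition coboundaries n : submodule (cochains L n) :=
  if n is m.+1 then image_submod (@coboundary _ _ _ L m) else zero_submod (cochains L 0).

Definition homology n := subquotient (cycles n) (boundaries n).
Definition cohomology n := subquotient (cocycles n) (coboundaries n).

End Homology.

(* R or C, as a ring equipped with its absolute value and its embedding of the
   real numbers; see [real_scalars] and [complex_scalars]. *)
Record scalars (R : realType) := Scalars {
  scalar_ring :> comNzRingType;
  absv : scalar_ring -> R;
  real_embedding : {rmorphism R -> scalar_ring};
  absv_ge0 : forall a, 0 <= absv a;
  absvM : forall a b, absv (a * b) = absv a * absv b;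
  absvD : forall a b, absv (a + b) <= absv a + absv b;
  absv_real : forall r, absv (real_embedding r) = `|r| }.

Definition real_scalars (R : realType) : scalars R :=
  @Scalars R R (fun x => `|x|) idfun (@normr_ge0 R R) (@normrM R) (@ler_normD R R)
    (fun=> erefl).

Section ComplexScalars.
Variable R : realType.
Local Notation normc := (@ComplexField.Normc.normc R).

Lemma normc_ge0 (z : R[i]) : 0 <= normc z.
Proof. by case: z => a b; exact: sqrtr_ge0. Qed.

Lemma normc_real (r : R) : normc (real_complex R r) = `|r|.
Proof. by rewrite /= expr0n addr0 sqrtr_sqr. Qed.

Definition complex_scalars : scalars R :=
  @Scalars R R[i] normc (real_complex R) normc_ge0 (@ComplexField.Normc.normcM R)
    (@le_normcD R) normc_real.

End ComplexScalars.

Section TopologicalCoefficients.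
Variables (R : realType) (F : scalars R) (G : groupType).

(* Coefficients topologised by a family of quasi-norms with a common constant
   in the quasi-triangle inequality. The family has one member for l^p, c_0 and
   H^{s,p} with s finite; for H^{oo,p} it consists of all the norms of the
   H^{r,p}, which generate the projective limit topology. *)
Record topological_coefficients := TopologicalCoefficients {
  top_coef :> coefficients F^o G;
  quasinorm_index : Type;
  quasinorm : quasinorm_index -> (G -> F) -> \bar R;
  quasinorm_const : R;
  quasinorm_const_ge0 : 0 <= quasinorm_const;
  quasinorm0 : forall i, quasinorm i (fun=> 0) = 0%E;
  quasinormZ : forall i a f,
    (quasinorm i (fun x => a * f x)%R <= (absv a)%:E * quasinorm i f)%E;
  quasinormD : forall i f g,
    (quasinorm i (fun x => f x + g x)%R <=
       quasinorm_const%:E * (quasinorm i f + quasinorm i g))%E }.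


Lemma absv0 : absv (0 : F) = 0.
Proof. by rewrite -(rmorph0 (real_embedding F)) absv_real normr0. Qed.

Lemma absvN1 : absv (-1 : F) = 1.
Proof. by rewrite -(rmorph1 (real_embedding F)) -rmorphN absv_real normrN normr1. Qed.

Lemma absv1 : absv (1 : F) = 1.
Proof. by rewrite -(rmorph1 (real_embedding F)) absv_real normr1. Qed.

Lemma absvN (a : F) : absv (- a) = absv a.
Proof. by rewrite -mulN1r absvM absvN1 mul1r. Qed.

Variable L : topological_coefficients.

Definition coef_space : Type := submod_type L.
HB.instance Definition _ := GRing.Lmodule.on coef_space.

Definition coef_entourage : set_system (coef_space * coef_space) :=
  [set E | exists2 A : set (quasinorm_index L), finite_set A &
    exists2 e : R, 0 < e & forall f g : coef_space,
      (forall i, A i ->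
        (quasinorm i (submod_val f - submod_val g)%R < e%:E)%E) -> E (f, g)].

Lemma quasinorm_lt (x y : G -> F) (a : F) i (e : R) :
  let d := e / ((1 + quasinorm_const L) * (absv a + 2)) in 0 < e ->
  (quasinorm (t := L) i x < d%:E)%E -> (quasinorm (t := L) i y < d%:E)%E ->
  (quasinorm (t := L) i (fun t => a * x t + y t)%R < e%:E)%E.
Proof.
move=> d e0 xd yd.
have C0 := quasinorm_const_ge0 L; have a0 := absv_ge0 a.
have C1 : 0 < 1 + quasinorm_const L by rewrite ltr_wpDr.
have a2 : 0 < absv a + 2 by rewrite ltr_wpDl.
have d0 : 0 < d by rewrite divr_gt0 // mulr_gt0.
apply: (@le_lt_trans _ _
  ((quasinorm_const L)%:E * ((absv a)%:E * d%:E + d%:E))%E).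
  apply: le_trans (quasinormD _ _ _) _.
  apply: lee_wpmul2l; first by rewrite lee_fin.
  apply: leeD; last exact: ltW.
  apply: le_trans (quasinormZ _ _ _) _.
  by apply: lee_wpmul2l; [rewrite lee_fin | exact: ltW].
rewrite -!EFinM lte_fin.
have eE : e = (1 + quasinorm_const L) * ((absv a + 2) * d).
  by rewrite /d mulrA mulrC divfK // gt_eqF // mulr_gt0.
clearbody d; rewrite eE.
rewrite -{2}[d]mul1r -mulrDl.
apply: (@le_lt_trans _ _ (quasinorm_const L * ((absv a + 2) * d))).
  by apply: ler_wpM2l => //; rewrite ler_pM2r // lerD2l ler1n.
have : 0 < (absv a + 2) * d by rewrite mulr_gt0.
by move=> X0; rewrite [ltRHS]mulrDl mul1r ltrDr.
Qed.

Lemma coef_entourage_filter : Filter coef_entourage.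
Proof.
split.
- by exists set0 => //; exists 1.
- move=> P Q [A fA [d d0 AP]] [B fB [e e0 BQ]].
  exists (A `|` B); first by rewrite finite_setU.
  exists (Num.min d e); first by rewrite lt_min d0.
  move=> f g h; split.
    apply: AP => i Ai; have := h i (or_introl Ai).
    by move=> /lt_le_trans; apply; rewrite lee_fin ge_min lexx.
  apply: BQ => i Bi; have := h i (or_intror Bi).
  by move=> /lt_le_trans; apply; rewrite lee_fin ge_min lexx orbT.
- move=> P Q PQ [A fA [d d0 AP]]; exists A => //; exists d => // f g h.
  exact/PQ/AP.
Qed.

Lemma coef_entourage_refl E : coef_entourage E -> diagonal `<=` E.
Proof.
move=> [A fA [d d0 AE]] [f g]; rewrite /diagonal /= => <-; apply: AE => i _.
by rewrite subrr (quasinorm0 i) lte_fin.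
Qed.

Lemma coef_entourage_inv E : coef_entourage E -> coef_entourage E^-1%relation.
Proof.
move=> [A fA [d d0 AE]]; exists A => //; exists d => // f g h; apply: AE => i Ai.
apply: le_lt_trans (h i Ai).
rewrite (_ : (_ - _)%R = fun x => -1 * (submod_val f - submod_val g) x); last first.
  by apply/funext => x; rewrite mulN1r -[RHS]/(- (_ - _)) opprB.
by apply: le_trans (quasinormZ _ _ _) _; rewrite absvN1 mul1e.
Qed.

Lemma coef_entourage_split E : coef_entourage E ->
  exists2 E', coef_entourage E' & (E' \; E' `<=` E)%relation.
Proof.
move=> [A fA [e e0 AE]].
pose d := e / ((1 + quasinorm_const L) * (absv (1 : F) + 2)).
exists [set fg : coef_space * coef_space | forall i, A i ->
    (quasinorm i (submod_val fg.1 - submod_val fg.2)%R < d%:E)%E].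
  exists A => //; exists d => //.
  rewrite divr_gt0 // mulr_gt0 //.
    by rewrite ltr_wpDr // quasinorm_const_ge0.
  by rewrite ltr_wpDl // absv_ge0.
move=> [f g] [h /= fh hg]; apply: AE => i Ai.
have := quasinorm_lt e0 (fh i Ai) (hg i Ai).
rewrite (_ : (fun=> _) = submod_val f - submod_val g) //.
apply/funext => x; rewrite mul1r.
by rewrite -[LHS]/((_ - _) + (_ - _)) addrA subrK.
Qed.

HB.instance Definition _ := isUniform.Build coef_space coef_entourage_filter
  coef_entourage_refl coef_entourage_inv coef_entourage_split.

Lemma coef_spaceP (a : F) (x y : coef_space) :
  (a *: z.1 + z.2 : coef_space) @[z --> (x, y)] --> (a *: x + y : coef_space).
Proof.
move=> U /nbhsP [E [A fA [e e0 AE]] EU].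
pose d := e / ((1 + quasinorm_const L) * (absv a + 2)).
have d0 : 0 < d.
  rewrite divr_gt0 // mulr_gt0 //.
    by rewrite ltr_wpDr // quasinorm_const_ge0.
  by rewrite ltr_wpDl // absv_ge0.
pose D := [set fg : coef_space * coef_space | forall i, A i ->
    (quasinorm i (submod_val fg.1 - submod_val fg.2)%R < d%:E)%E].
have entD : entourage D by exists A => //; exists d.
exists (xsection D x, xsection D y).
  by split; apply/nbhsP; exists D.
move=> [z t] [] /=; rewrite /xsection /= !inE => Dz Dt.
apply: EU; rewrite /xsection /= inE; apply: AE => i Ai.
have := quasinorm_lt e0 (Dz i Ai) (Dt i Ai).
rewrite (_ : (fun=> _) = submod_val (a *: x + y) - submod_val (a *: z + t)) //.
apply/funext => s.
rewrite -[RHS]/(a * submod_val x s + submod_val y s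
  - (a * submod_val z s + submod_val t s)).
rewrite -[LHS]/(a * (submod_val x s - submod_val z s)
  + (submod_val y s - submod_val t s)).
by rewrite mulrBr opprD addrACA.
Qed.

End TopologicalCoefficients.

Lemma initial_cvgE (S : choiceType) (T : topologicalType) (f : S -> T)
    (Q : set_system S) (s : S) : Filter Q ->
  (Q --> (s : initial_topology f)) <-> f @ Q --> f s.
Proof.
move=> FQ; split=> [Qs A|fQ A].
  by move=> nA; apply: Qs; exact: (@initial_continuous S T f s A nA).
rewrite nbhsE => -[_ [[B oB <-] Bs] BA].
have /fQ : nbhs (f s) B by exact: open_nbhs_nbhs.
by move=> QB; exact: (filterS BA QB).
Qed.

Section PointwiseTopology.
Variables (R : realType) (F : scalars R) (G : groupType).
Variables (L : topological_coefficients F G) (V : lmodType F) (I : choiceType).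
Variable sl : V -> {ptws I -> coef_space L}.
Hypothesis slP : forall a u v i, sl (a *: u + v) i = a *: sl u i + sl v i.

Local Notation T := (initial_topology sl).

Lemma pointwise_topologyE (Q : set_system T) (c : T) : Filter Q ->
  (Q --> c) <-> forall i, sl b i @[b --> Q] --> sl c i.
Proof.
move=> FQ; rewrite (initial_cvgE sl) cvg_sup.
split=> h i.
  by have := h i; rewrite (@initial_cvgE _ _ (fun f : I -> coef_space L => f i)).
by rewrite (@initial_cvgE _ _ (fun f : I -> coef_space L => f i)); exact: h.
Qed.

Variable B : submodule V.

Lemma pointwise_closure0 : closure (B : set T) (0 : V).
Proof. by apply: subset_closure; exact: submod0. Qed.

Lemma pointwise_closureP (a : F) (u v : V) : closure (B : set T) u ->
  closure (B : set T) v -> closure (B : set T) (a *: u + v).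
Proof.
move=> Bu Bv U nU.
have : (a *: z.1 + z.2 : T) @[z --> ((u : T), (v : T))] --> (a *: u + v : T).
  apply/pointwise_topologyE => i; rewrite slP.
  rewrite -[X in X --> _]/((sl (a *: z.1 + z.2) i) @[z --> ((u : T), (v : T))]).
  rewrite (_ : (fun z => _) = (fun z : T * T => a *: sl z.1 i + sl z.2 i)); last first.
    by apply/funext => z; exact: slP.
  have slc (x : T) : sl b i @[b --> x] --> sl x i.
    by have /pointwise_topologyE : (x : T) --> (x : T) by exact: cvg_id.
  apply: (@cvg_comp _ _ _ (fun z : T * T => (sl z.1 i, sl z.2 i))
    (fun w => a *: w.1 + w.2) _ (nbhs (sl u i, sl v i))); last exact: coef_spaceP.
  move=> A [[P Q] /= [uP vQ] PQA].
  exists ([set x | P (sl x i)], [set x | Q (sl x i)]).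
    by split; [exact: (slc u _ uP) | exact: (slc v _ vQ)].
  by move=> [x y] [] /= Px Qy; exact: (PQA (_, _)).
move=> /(_ _ nU) [[P Q] /= [uP vQ] PQ].
have [x [Bx Px]] := Bu _ uP; have [y [By Qy]] := Bv _ vQ.
exists (a *: x + y); split; first exact: submodP.
exact: (PQ (x, y)).
Qed.

Definition pointwise_closure : submodule V :=
  Submodule pointwise_closure0 pointwise_closureP.

End PointwiseTopology.

Section ReducedHomology.
Variables (R : realType) (F : scalars R) (G : groupType).
Variable L : topological_coefficients F G.

Definition chain_slice n (c : chains L n) : {ptws n.-tuple G -> coef_space L} :=
  fun g => mk_submod (proj1 (submodE c) g).

Lemma chain_sliceP n (a : F) (u v : chains L n) g :
  chain_slice (a *: u + v) g = a *: chain_slice u g + chain_slice v g.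
Proof. exact: val_inj. Qed.

(* the topology of pointwise convergence, see [chain_space_cvgE] *)
Definition chain_space n : topologicalType := initial_topology (@chain_slice n).

Lemma chain_space_cvgE n (Q : set_system (chain_space n)) (c : chains L n) : Filter Q ->
  (Q --> (c : chain_space n)) <-> forall g, chain_slice b g @[b --> Q] --> chain_slice c g.
Proof. exact: (pointwise_topologyE (sl := _)). Qed.

Definition cochain_slice n (c : cochains L n) : {ptws n.-tuple G -> coef_space L} :=
  fun g => mk_submod (submodE c g).

Lemma cochain_sliceP n (a : F) (u v : cochains L n) g :
  cochain_slice (a *: u + v) g = a *: cochain_slice u g + cochain_slice v g.
Proof. exact: val_inj. Qed.

Definition cochain_space n : topologicalType := initial_topology (@cochain_slice n).

Lemma cochain_space_cvgE n (Q : set_system (cochain_space n)) (c : cochains L n) : Filter Q ->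
  (Q --> (c : cochain_space n)) <-> forall g, cochain_slice b g @[b --> Q] --> cochain_slice c g.
Proof. exact: (pointwise_topologyE (sl := _)). Qed.

Definition closed_boundaries n : submodule (chains L n) :=
  pointwise_closure (@chain_sliceP n) (boundaries L n).

Definition closed_coboundaries n : submodule (cochains L n) :=
  pointwise_closure (@cochain_sliceP n) (coboundaries L n).

Lemma closed_boundariesE n :
  submod_set (closed_boundaries n) = closure (boundaries L n : set (chain_space n)).
Proof. by []. Qed.

Lemma closed_coboundariesE n :
  submod_set (closed_coboundaries n) = closure (coboundaries L n : set (cochain_space n)).
Proof. by []. Qed.

Definition reduced_homology n := subquotient (cycles L n) (closed_boundaries n).
Definition reduced_cohomology n :=
  subquotient (cocycles L n) (closed_coboundaries n).

End ReducedHomology.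

Section CoarseMaps.
Variables (G H : groupType).

Definition coarse_map (phi : G -> H) : Prop :=
  (forall y, finite_set (phi @^-1` [set y])) /\
  (forall S : set (G * G),
    finite_set [set (p.1 * p.2^-1)%g | p in S] ->
    finite_set [set (phi p.1 * (phi p.2)^-1)%g | p in S]).

Definition close (phi psi : G -> H) : Prop :=
  finite_set [set (phi x * (psi x)^-1)%g | x in [set: G]].

End CoarseMaps.

Definition coarse_equivalence (G H : groupType) (phi : G -> H) : Prop :=
  coarse_map phi /\
  exists psi : H -> G,
    [/\ coarse_map psi, close (psi \o phi) id & close (phi \o psi) id].

(* [r] is the graph of a map V -> V', which is required to be everywhere
   defined, to send Z to Z', and to induce on the subquotients a well-defined
   map f that is an isomorphism of modules. *)
Definition induces_iso (R : pzRingType) (V V' : lmodType R)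
    (Z B : submodule V) (Z' B' : submodule V') (r : V -> V' -> Prop) : Prop :=
  (forall c, exists d, r c d) /\
  exists f : {linear subquotient Z B -> subquotient Z' B'},
    bijective f /\
    forall z, exists2 z', r (submod_val z) (submod_val z') &
      f (subq_class B z) = subq_class B' z'.

Section InducedMaps.
Variables (G H : groupType) (phi : G -> H).

Definition pushes (R : comPzRingType) (W : lmodType R) (LG : coefficients W G)
    (LH : coefficients W H) n (c : chains LG n) (d : chains LH n) : Prop :=
  submod_val d = pushforward (@simplex_map G H phi n) (submod_val c).

Definition pulls (R : comPzRingType) (W : lmodType R) (LG : coefficients W G)
    (LH : coefficients W H) n (d : cochains LH n) (c : cochains LG n) : Prop :=
  submod_val c = submod_val d \o @simplex_map G H phi n.

Definition homology_iso (R : comPzRingType) (W : lmodType R)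
    (LG : coefficients W G) (LH : coefficients W H) : Prop :=
  forall n, induces_iso (cycles LG n) (boundaries LG n)
    (cycles LH n) (boundaries LH n) (@pushes _ _ LG LH n).

Definition cohomology_iso (R : comPzRingType) (W : lmodType R)
    (LG : coefficients W G) (LH : coefficients W H) : Prop :=
  forall n, induces_iso (cocycles LH n) (coboundaries LH n)
    (cocycles LG n) (coboundaries LG n) (@pulls _ _ LG LH n).

Definition reduced_homology_iso (R : realType) (F : scalars R)
    (LG : topological_coefficients F G) (LH : topological_coefficients F H) : Prop :=
  forall n, induces_iso (cycles LG n) (closed_boundaries LG n)
    (cycles LH n) (closed_boundaries LH n) (@pushes _ _ LG LH n).

Definition reduced_cohomology_iso (R : realType) (F : scalars R)
    (LG : topological_coefficients F G) (LH : topological_coefficients F H) : Prop :=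
  forall n, induces_iso (cocycles LH n) (closed_coboundaries LH n)
    (cocycles LG n) (closed_coboundaries LG n) (@pulls _ _ LG LH n).

End InducedMaps.

Section AlgebraicCoefficients.
Variables (R : comPzRingType) (W : lmodType R) (G : groupType).

Definition all_functions : coefficients W G :=
  @Coefficients _ _ _ (full_submod ((G -> W) : lmodType R)) (fun _ _ _ => I).

Definition finite_valued_set : set (G -> W) := [set f | finite_set (range f)].

Lemma finite_valued0 : finite_valued_set 0.
Proof.
apply: (@sub_finite_set _ _ [set 0 : W]) => //.
by move=> _ [x _ <-].
Qed.

Lemma finite_valuedP a u v : finite_valued_set u -> finite_valued_set v ->
  finite_valued_set (a *: u + v).
Proof.
move=> fu fv.
apply: sub_finite_set (finite_image2 (fun x y => a *: x + y) fu fv).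
by move=> _ [x _ <-]; exists (u x); [exists x | exists (v x); [exists x|]].
Qed.

Lemma finite_valued_translate g f :
  finite_valued_set f -> finite_valued_set (translate g f).
Proof. by apply: sub_finite_set => _ [x _ <-]; exists (g^-1 * x)%g. Qed.

Definition finite_valued : coefficients W G :=
  @Coefficients _ _ _ (@Submodule _ ((G -> W) : lmodType R) _ finite_valued0 finite_valuedP)
    finite_valued_translate.

Definition finite_support_set : set (G -> W) :=
  [set f | finite_set [set x | f x <> 0]].

Lemma finite_supp0 : finite_support_set 0.
Proof.
rewrite /finite_support_set /= (_ : [set x | _] = set0) //.
by apply/seteqP; split => // x; apply.
Qed.

Lemma finite_suppP a u v : finite_support_set u -> finite_support_set v ->
  finite_support_set (a *: u + v).
Proof.
move=> fu fv; apply: (@sub_finite_set _ _ ([set x | u x <> 0] `|` [set x | v x <> 0])).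
  move=> x /= uvx; apply: contrapT => /not_orP[/contrapT u0 /contrapT v0].
  by apply: uvx; rewrite -[LHS]/(a *: u x + v x) u0 v0 scaler0 addr0.
by rewrite finite_setU.
Qed.

Lemma finite_supp_translate g f :
  finite_support_set f -> finite_support_set (translate g f).
Proof.
move=> ff; apply: sub_finite_set (finite_image (fun x => g * x)%g ff).
by move=> x /= fx; exists (g^-1 * x)%g => //; rewrite mulVKg.
Qed.

Definition finitely_supported : coefficients W G :=
  @Coefficients _ _ _ (@Submodule _ ((G -> W) : lmodType R) _ finite_supp0 finite_suppP)
    finite_supp_translate.

End AlgebraicCoefficients.

Section LpNorm.
Variables (R : realType) (F : scalars R) (G : groupType).
Implicit Types (f g : G -> F) (p : \bar R).

(* The value at p = -oo is a dummy: only 0 < p is ever used. *)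
Definition lpnorm p f : \bar R :=
  match p with
  | r%:E => ((\esum_(x in [set: G]) (absv (f x) `^ r)%:E) `^ r^-1)%E
  | +oo%E => ereal_sup [set (absv (f x))%:E | x in [set: G]]
  | -oo%E => 0%E
  end.

Lemma lpnorm_le p f g (c : R) : (0 < p)%E -> 0 <= c ->
  (forall x, absv (f x) <= c * absv (g x)) -> (lpnorm p f <= c%:E * lpnorm p g)%E.
Proof.
move=> p0 c0 fg; case: p p0 => [r| |] //=; last first.
  move=> _; apply: ge_ereal_sup => _ [x _ <-].
  apply: (@le_trans _ _ (c%:E * (absv (g x))%:E)%E); first by rewrite lee_fin.
  by apply: lee_wpmul2l; rewrite ?lee_fin //; apply: ereal_sup_ubound; exists x.
rewrite lte_fin => r0.
have cE : c%:E = ((c `^ r)%:E `^ r^-1)%E.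
  by rewrite poweR_EFin -powRrM mulfV ?gt_eqF // powRr1.
have g0 : (0 <= \esum_(x in [set: G]) (absv (g x) `^ r)%:E)%E.
  by apply: esum_ge0 => x _; rewrite lee_fin powR_ge0.
have cr0 : (0 <= (c `^ r)%:E)%E by rewrite lee_fin powR_ge0.
rewrite cE -poweRM //.
have ir0 : 0 <= r^-1 by rewrite invr_ge0 ltW.
apply: (gt0_ler_poweR ir0); rewrite ?in_itv /= ?leey ?andbT //.
- by apply: esum_ge0 => x _; rewrite lee_fin powR_ge0.
- exact: mule_ge0.
apply: ge_ereal_sup => _ [A [fA _] <-].
apply: (@le_trans _ _ (\sum_(x \in A) ((c `^ r)%:E * (absv (g x) `^ r)%:E))%E).
  apply: lee_fsum => // x _; rewrite -EFinM lee_fin -powRM ?absv_ge0 //.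
  by apply: ge0_ler_powR; rewrite ?nnegrE ?absv_ge0 ?mulr_ge0 ?absv_ge0 // ltW.
rewrite -ge0_mule_fsumr //; last by move=> x; rewrite lee_fin powR_ge0.
by apply: lee_wpmul2l => //; apply: ereal_sup_ubound; exists A.
Qed.

Definition lpconst p : R := if p is r%:E then 2 * 2 `^ r^-1 else 1.

Lemma lpconst_ge0 p : 0 <= lpconst p.
Proof. by case: p => [r| |] //=; rewrite mulr_ge0 // powR_ge0. Qed.

Lemma lpnorm_ge0 p f : (0 <= lpnorm p f)%E.
Proof.
case: p => [r| |] //=; first exact: poweR_ge0.
apply: (@le_trans _ _ (absv (f 1%g))%:E); first by rewrite lee_fin absv_ge0.
by apply: ereal_sup_ubound; exists 1%g.
Qed.

Lemma lpnormD p f g : (0 < p)%E ->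
  (lpnorm p (fun x => f x + g x)%R <= (lpconst p)%:E * (lpnorm p f + lpnorm p g))%E.
Proof.
move=> p0; case: p p0 => [r| |] //; last first.
  move=> _; rewrite mul1e; apply: ge_ereal_sup => _ [x _ <-].
  apply: (@le_trans _ _ ((absv (f x))%:E + (absv (g x))%:E)%E).
    by rewrite -EFinD lee_fin absvD.
  by apply: leeD; apply: ereal_sup_ubound; exists x.
rewrite lte_fin => r0.
have ir0 : 0 <= r^-1 by rewrite invr_ge0 ltW.
pose h1 x : R := Num.max (absv (f x)) (absv (g x)).
pose Sf := (\esum_(x in [set: G]) (absv (f x) `^ r)%:E)%E.
pose Sg := (\esum_(x in [set: G]) (absv (g x) `^ r)%:E)%E.
have Sf0 : (0 <= Sf)%E by apply: esum_ge0 => x _; rewrite lee_fin powR_ge0.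
have Sg0 : (0 <= Sg)%E by apply: esum_ge0 => x _; rewrite lee_fin powR_ge0.
pose S := (\esum_(x in [set: G]) ((h1 x) `^ r)%:E)%E.
have S0 : (0 <= S)%E by apply: esum_ge0 => x _; rewrite lee_fin powR_ge0.
have SE : (S <= Sf + Sg)%E.
  rewrite -esumD; try by move=> x _; rewrite lee_fin powR_ge0.
  apply: le_esum => x _; rewrite -EFinD lee_fin /h1.
  by rewrite /Num.max; case: ifP => _; rewrite ?lerDl ?lerDr powR_ge0.
have h10 x : 0 <= h1 x by rewrite /h1 le_max absv_ge0.
have le1 : (lpnorm r%:E (fun x => f x + g x)%R <= 2%:E * S `^ r^-1)%E.
  have two : (2%:E : \bar R) = ((2 `^ r)%:E `^ r^-1)%E.
    by rewrite poweR_EFin -powRrM mulfV ?gt_eqF // powRr1.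
  rewrite two -poweRM ?lee_fin ?powR_ge0 //.
  apply: (gt0_ler_poweR ir0); rewrite ?in_itv /= ?leey ?andbT //.
  - by apply: esum_ge0 => x _; rewrite lee_fin powR_ge0.
  - by rewrite mule_ge0 // lee_fin powR_ge0.
  apply: ge_ereal_sup => _ [A [fA _] <-].
  apply: (@le_trans _ _ (\sum_(x \in A) ((2 `^ r)%:E * ((h1 x) `^ r)%:E))%E).
    apply: lee_fsum => // x _; rewrite -EFinM lee_fin -powRM //.
    apply: ge0_ler_powR; rewrite ?nnegrE ?absv_ge0 ?mulr_ge0 ?(ltW r0) //.
    apply: le_trans (absvD _ _) _; rewrite mulr_natl mulr2n /h1.
    by apply: lerD; rewrite le_max lexx ?orbT.
  rewrite -ge0_mule_fsumr //; last by move=> x; rewrite lee_fin powR_ge0.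
  apply: lee_wpmul2l; first by rewrite lee_fin powR_ge0.
  by apply: ereal_sup_ubound; exists A.
apply: le_trans le1 _; rewrite /lpconst EFinM -muleA.
apply: lee_wpmul2l => //.
have mono (a b : \bar R) : (0 <= a)%E -> (a <= b)%E -> (a `^ r^-1 <= b `^ r^-1)%E.
  move=> a0 ab; apply: (gt0_ler_poweR ir0); rewrite ?in_itv /= ?leey ?andbT //.
  exact: le_trans ab.
rewrite -[lpnorm r%:E f]/(Sf `^ r^-1)%E -[lpnorm r%:E g]/(Sg `^ r^-1)%E.
clearbody Sf Sg S.
wlog fg : Sf Sg Sf0 Sg0 SE / (Sf <= Sg)%E => [hw|].
  case/orP: (le_total Sf Sg) => h; first exact: hw.
  have := hw Sg Sf Sg0 Sf0; rewrite addeC => /(_ SE h).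
  by rewrite [X in (_ <= _ * X)%E -> _]addeC.
have le2 : (S <= 2%:E * Sg)%E.
  apply: le_trans SE _.
  have -> : (2%:E * Sg = Sg + Sg)%E by rewrite mule_natl mule2n.
  exact: leeD.
apply: le_trans (mono _ _ S0 le2) _.
rewrite poweRM ?lee_fin // poweR_EFin.
apply: lee_wpmul2l; first by rewrite lee_fin powR_ge0.
by rewrite leeDr // poweR_ge0.
Qed.

Lemma lpnorm0 p : (0 < p)%E -> lpnorm p (fun=> 0) = 0%E.
Proof.
move=> p0; apply/eqP; rewrite eq_le lpnorm_ge0 andbT.
have := @lpnorm_le p (fun=> 0) (fun=> 0) 0 p0 (lexx 0).
by rewrite mul0e; apply => x; rewrite absv0 mul0r.
Qed.

Lemma lpnormZ p (a : F) f : (0 < p)%E ->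
  (lpnorm p (fun x => a * f x)%R <= (absv a)%:E * lpnorm p f)%E.
Proof.
by move=> p0; apply: lpnorm_le => // [|x]; rewrite ?absv_ge0 // absvM.
Qed.

Lemma lpnorm_translate p (y : G) f :
  lpnorm p (fun x => f (y^-1 * x)%g) = lpnorm p f.
Proof.
case: p => [r| |] //=.
  congr (_ `^ _)%E; rewrite [RHS](reindex_esum [set: G] [set: G] (fun x => y^-1 * x)%g) //.
  split => // [x x' _ _ /mulgI //|x _].
  by exists (y * x)%g => //; rewrite mulKg.
congr ereal_sup; apply/seteqP; split => _ [x _ <-].
  by exists (y^-1 * x)%g.
by exists (y * x)%g => //; rewrite mulKg.
Qed.

End LpNorm.

Section WordLength.
Variable G : groupType.

Definition is_word (S : set G) (x : G) (n : nat) : Prop :=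
  exists w : seq G, [/\ size w = n, forall s, s \in w -> S s
                     & x = (\prod_(s <- w) s)%g].

Record generating_set := GeneratingSet {
  generators :> set G;
  generators_finite : finite_set generators;
  generators_symmetric : forall s, generators s -> generators s^-1%g;
  generators_generate : forall x, exists n, is_word generators x n }.

Variable S : generating_set.

Definition word_length (x : G) : nat :=
  ex_minn (let: ex_intro n Sxn := generators_generate S x in
           ex_intro (fun n => `[< is_word S x n >]) n (asboolT Sxn)).

Lemma word_lengthP x : is_word S x (word_length x).
Proof. by rewrite /word_length; case: ex_minnP => n /asboolP. Qed.

Lemma word_length_le x n : is_word S x n -> (word_length x <= n)%N.
Proof.
by rewrite /word_length; case: ex_minnP => m _ mmin Sxn; apply/mmin/asboolT.
Qed.

Lemma word_lengthM x y : (word_length (x * y)%g <= word_length x + word_length y)%N.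
Proof.
have [v [sv Sv xE]] := word_lengthP x; have [w [sw Sw yE]] := word_lengthP y.
apply: word_length_le; exists (v ++ w); split.
- by rewrite size_cat sv sw.
- by move=> s; rewrite mem_cat => /orP[/Sv|/Sw].
- by rewrite big_cat /= -xE -yE.
Qed.

End WordLength.

Section TopologicalExamples.
Variables (R : realType) (F : scalars R) (G : groupType).
Implicit Types (f : G -> F) (p s : \bar R).

Local Notation fct := ((G -> F^o) : lmodType F).

Definition lp_set p : set (G -> F^o) := [set f | (lpnorm p f < +oo)%E].

Lemma lpnorm_lty_le p (f g : G -> F) (c : R) : (0 < p)%E -> 0 <= c ->
  (forall x, absv (f x) <= c * absv (g x)) ->
  (lpnorm p g < +oo)%E -> (lpnorm p f < +oo)%E.
Proof.
move=> p0 c0 fg goo; apply: le_lt_trans (lpnorm_le p0 c0 fg) _.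
by rewrite lte_mul_pinfty ?lee_fin.
Qed.

Lemma lpnorm_ltyP p a (f g : G -> F) : (0 < p)%E ->
  (lpnorm p f < +oo)%E -> (lpnorm p g < +oo)%E ->
  (lpnorm p (fun x => a * f x + g x)%R < +oo)%E.
Proof.
move=> p0 foo goo; apply: le_lt_trans (lpnormD _ _ p0) _.
apply: lte_mul_pinfty; rewrite ?lee_fin ?lpconst_ge0 //.
apply: lte_add_pinfty => //.
by apply: (lpnorm_lty_le p0 (absv_ge0 a) _ foo) => x; rewrite absvM.
Qed.

Lemma lp0 p : (0 < p)%E -> lp_set p 0.
Proof. by move=> p0; rewrite /lp_set /= (lpnorm0 F G p0). Qed.

Lemma lpP p (p0 : (0 < p)%E) a u v : lp_set p u -> lp_set p v -> lp_set p (a *: u + v).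
Proof. exact: lpnorm_ltyP. Qed.

Lemma lp_translate p (g : G) f : lp_set p f -> lp_set p (translate (W := F^o) g f).
Proof. by rewrite /lp_set /= /translate lpnorm_translate. Qed.

Definition lp_coefficients p (p0 : (0 < p)%E) : coefficients F^o G :=
  @Coefficients _ _ _ (@Submodule _ fct _ (lp0 p0) (lpP p0)) (@lp_translate p).

Definition lp_space p (p0 : (0 < p)%E) : topological_coefficients F G :=
  @TopologicalCoefficients _ _ _ (lp_coefficients p0) unit
    (fun=> lpnorm p) _ (lpconst_ge0 p)
    (fun=> lpnorm0 F G p0) (fun _ a f => lpnormZ a f p0)
    (fun _ f g => lpnormD f g p0).

Definition c0_set : set (G -> F^o) :=
  [set f | forall e : R, 0 < e -> finite_set [set x | e <= absv (f x)]].

Lemma c00 : c0_set 0.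
Proof.
move=> e e0; rewrite (_ : [set x | _] = set0) //.
by apply/seteqP; split => // x /=; rewrite absv0 leNgt e0.
Qed.

Lemma c0P a u v : c0_set u -> c0_set v -> c0_set (a *: u + v).
Proof.
move=> u0 v0 e e0; pose d := e / (2 * (absv a + 1)).
have a1 : 0 < absv a + 1 by rewrite ltr_wpDl // absv_ge0.
have d0 : 0 < d by rewrite divr_gt0 // mulr_gt0.
have e20 : 0 < e / 2 by rewrite divr_gt0.
apply: (@sub_finite_set _ _ ([set x | d <= absv (u x)] `|` [set x | e / 2 <= absv (v x)])); last first.
  by rewrite finite_setU; split; [exact: u0 | exact: v0].
move=> x /= ex; apply: contrapT => /not_orP[/negP + /negP]; rewrite -!ltNge => ux vx.
move: ex; apply/negP; rewrite -ltNge.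
apply: le_lt_trans (absvD _ _) _; rewrite [e]splitr -[X in absv X]/(a * u x) absvM.
apply: ler_ltD => //; apply: (@le_trans _ _ (absv a * d)).
  by apply: ler_wpM2l; rewrite ?absv_ge0 // ltW.
rewrite /d mulrA ler_pdivrMr ?mulr_gt0 // mulrA divfK ?pnatr_eq0 // mulrC.
by rewrite ler_pM2l // lerDl.
Qed.

Lemma c0_translate (g : G) f : c0_set f -> c0_set (translate (W := F^o) g f).
Proof.
move=> f0 e e0; apply: sub_finite_set (finite_image (fun x => g * x)%g (f0 e e0)).
by move=> x /= fx; exists (g^-1 * x)%g => //; rewrite mulVKg.
Qed.

Definition c0_coefficients : coefficients F^o G :=
  @Coefficients _ _ _ (@Submodule _ fct _ c00 c0P) c0_translate.

Definition c0_space : topological_coefficients F G :=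
  @TopologicalCoefficients _ _ _ c0_coefficients unit
    (fun=> lpnorm +oo) _ (lpconst_ge0 +oo)
    (fun=> lpnorm0 F G (ltry 0)) (fun _ a f => lpnormZ a f (ltry 0))
    (fun _ f g => lpnormD f g (ltry 0)).

Section Sobolev.
Variable S : generating_set G.

Definition weight (r : R) (x : G) : R := (1 + (word_length S x)%:R) `^ r.

Definition weighted (r : R) f : G -> F :=
  fun x => f x * real_embedding F (weight r x).

Definition sobolev_norm p (r : R) f : \bar R := lpnorm p (weighted r f).

(* H^{s,p} is the intersection of the H^{r,p} over [orders s]; s ranges over
   the reals and +oo, the value at -oo being a dummy. *)
Definition orders s : set R := if s is r%:E then [set r] else setT.

Definition sobolev_set s p : set (G -> F^o) :=
  [set f | forall r, orders s r -> (sobolev_norm p r f < +oo)%E].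

Lemma sobolev_norm0 p r : (0 < p)%E -> sobolev_norm p r (fun=> 0) = 0%E.
Proof.
move=> p0; rewrite -(lpnorm0 F G p0); congr lpnorm.
by apply/funext => x; rewrite /weighted mul0r.
Qed.

Lemma sobolev_normZ p r a f : (0 < p)%E ->
  (sobolev_norm p r (fun x => a * f x)%R <= (absv a)%:E * sobolev_norm p r f)%E.
Proof.
move=> p0; rewrite /sobolev_norm.
rewrite (_ : weighted r _ = fun x => a * weighted r f x); first exact: lpnormZ.
by apply/funext => x; rewrite /weighted mulrA.
Qed.

Lemma sobolev_normD p r f (g : G -> F) : (0 < p)%E ->
  (sobolev_norm p r (fun x => f x + g x)%R <=
    (lpconst p)%:E * (sobolev_norm p r f + sobolev_norm p r g))%E.
Proof.
move=> p0; rewrite /sobolev_norm.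
rewrite (_ : weighted r _ = fun x => weighted r f x + weighted r g x).
  exact: lpnormD.
by apply/funext => x; rewrite /weighted mulrDl.
Qed.

Lemma sobolev0 s p : (0 < p)%E -> sobolev_set s p 0.
Proof. by move=> p0 r _; rewrite sobolev_norm0. Qed.

Lemma sobolevP s p (p0 : (0 < p)%E) a u v :
  sobolev_set s p u -> sobolev_set s p v -> sobolev_set s p (a *: u + v).
Proof.
move=> us vs r sr; have := lpnorm_ltyP a p0 (us r sr) (vs r sr).
rewrite /sobolev_norm (_ : (fun=> _) = weighted r (a *: u + v)) //.
by apply/funext => x; rewrite /weighted mulrA -mulrDl.
Qed.

Lemma weight_ge0 r x : 0 <= weight r x.
Proof. exact: powR_ge0. Qed.

Lemma weight_le r (y : G) : exists2 c, 0 <= c &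
  forall x, weight r x <= c * weight r (y^-1 * x)%g.
Proof.
have l1 x : 1 <= 1 + (word_length S x)%:R :> R by rewrite lerDl.
have l0 x : 0 <= 1 + (word_length S x)%:R :> R by rewrite addr_ge0.
have lp x : 0 < 1 + (word_length S x)%:R :> R by rewrite ltr_wpDr.
have lM x z : 1 + (word_length S (x * z)%g)%:R <=
    (1 + (word_length S x)%:R) * (1 + (word_length S z)%:R) :> R.
  rewrite !nat1r -natrM ler_nat mulSn mulnS addSn ltnS addnCA.
  by apply: leq_trans (word_lengthM S x z) _; rewrite leq_add2l leq_addr.
have [r0|r0] := leP 0 r.
  exists (weight r y); first exact: weight_ge0.
  move=> x; rewrite /weight -powRM //.
  apply: ge0_ler_powR; rewrite ?nnegrE ?mulr_ge0 //.
  by have := lM y (y^-1 * x)%g; rewrite mulVKg.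
exists (weight (- r) y^-1%g); first exact: weight_ge0.
move=> x; rewrite /weight -[r in leLHS]opprK -[r in X in _ <= _ * X]opprK.
rewrite !(powRN _ (- r)) ler_pdivlMr ?powR_gt0 //.
rewrite mulrC ler_pdivrMr ?powR_gt0 // -powRM //.
apply: ge0_ler_powR; rewrite ?nnegrE ?mulr_ge0 ?oppr_ge0 ?(ltW r0) //.
Qed.

Lemma absv_weighted r f x : absv (weighted r f x) = absv (f x) * weight r x.
Proof. by rewrite /weighted absvM absv_real ger0_norm ?weight_ge0. Qed.

Lemma sobolev_translate s p (p0 : (0 < p)%E) (g : G) f :
  sobolev_set s p f -> sobolev_set s p (translate (W := F^o) g f).
Proof.
move=> fs r sr; have [c c0 cw] := weight_le r g.
have := fs r sr; rewrite /sobolev_norm -(lpnorm_translate p g).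
apply: (lpnorm_lty_le p0 c0) => x; rewrite !absv_weighted mulrCA.
by apply: ler_wpM2l; rewrite ?absv_ge0.
Qed.

Definition sobolev_coefficients s p (p0 : (0 < p)%E) : coefficients F^o G :=
  @Coefficients _ _ _ (@Submodule _ fct _ (@sobolev0 s p p0) (@sobolevP s p p0))
    (@sobolev_translate s p p0).

Definition sobolev_space s p (p0 : (0 < p)%E) : topological_coefficients F G :=
  @TopologicalCoefficients _ _ _ (sobolev_coefficients s p0)
    {r : R | orders s r} (fun r => sobolev_norm p (sval r)) _ (lpconst_ge0 p)
    (fun r => sobolev_norm0 (sval r) p0)
    (fun r a f => sobolev_normZ (sval r) a f p0)
    (fun r f g => sobolev_normD (sval r) f g p0).

End Sobolev.
End TopologicalExamples.

(* Main.v *)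
(* In the vertex coordinates x_0 = x, x_i = g_i^-1 x_{i-1} the bar complexes
   become complexes of functions of (x_0, ..., x_n): faces omit a vertex, phi
   acts on every vertex, and two close coarse maps are homotopic through the
   usual prism operators.  On the slice over a fixed tuple the ratios of the
   vertices of the image take finitely many values, so every induced map is, slice
   by slice, a finite sum of operators f |-> phi_*(1_A f), resp. 1_A (f o phi).
   If psi is a coarse inverse of phi, then x |-> psi(phi x) x^-1 has finite range
   and, together with phi x, determines x: G is cut into finitely many pieces on
   which phi is injective.  It thus suffices that the coefficients are stable
   under moving the values of a function along a partial injection contained in
   phi or its converse; this holds with norm bounds, because l^p-norms do not
   increase and coarse equivalences distort word lengths by bounded factors.
   On chains, pointwise continuity also needs that only finitely many slices
   contribute to a given one: phi(s) phi(t)^-1 determines s t^-1 up to a finite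
   set. *)

From HB Require Import structures.
From mathcomp Require Import all_boot all_order all_algebra.
From mathcomp Require Import all_classical reals ereal topology normedtype.
From mathcomp Require Import exp esum.
From mathcomp Require Import zify.
Require Import Defs.

Set Implicit Arguments.
Unset Strict Implicit.
Unset Printing Implicit Defensive.

Import Order.TTheory GRing.Theory Num.Theory.

Local Open Scope classical_set_scope.
Local Open Scope ring_scope.

(** * Vertex coordinates on simplices *)

Section Vertices.
Variable G : groupType.
Implicit Types (x : G) (v : nat -> G).

(** Over a fixed tuple the vertices move with [x] by right multiplication only: each is a constant
    depending on the tuple, times [x]. This is the form in which [coherent] is applied later. *)
Lemma vertex_shift n x (g : n.-tuple G) i : vertex x g i = (vertex 1 g i * x)%g.
Proof.
rewrite /vertex; elim: (take i g) x => [|a s IH] x /=; first by rewrite mul1g.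
by rewrite IH [in RHS]IH mulg1 mulgA.
Qed.

Lemma vertex0 n x (g : n.-tuple G) : vertex x g 0 = x.
Proof. by rewrite /vertex take0. Qed.

Lemma vertexS n x (g : n.-tuple G) (i : 'I_n) :
  vertex x g i.+1 = ((tnth g i)^-1 * vertex x g i)%g.
Proof.
by rewrite /vertex (take_nth 1%g) ?size_tuple // foldl_rcons (tnth_nth 1%g).
Qed.

Lemma vertex_ratio n x (g : n.-tuple G) (i : 'I_n) :
  (vertex x g i * (vertex x g i.+1)^-1)%g = tnth g i.
Proof. by rewrite vertexS invgM invgK mulVKg. Qed.

(** The inverse of the passage to vertices, by [vertex_of_vertices] and [of_vertices_vertex]. Only
    the values of [v] at 0, ..., n matter. *)
Definition of_vertices n v : G * n.-tuple G :=
  (v 0%N, [tuple (v i * (v i.+1)^-1)%g | i < n]).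

Lemma vertex_of_vertices n v i : (i <= n)%N ->
  vertex (of_vertices n v).1 (of_vertices n v).2 i = v i.
Proof.
elim: i => [|i IH] ltin; first by rewrite vertex0.
rewrite (vertexS _ _ (Ordinal ltin)) IH ?(ltnW ltin) //.
by rewrite tnth_mktuple invgM invgK mulgVK.
Qed.

Lemma of_vertices_vertex n x (g : n.-tuple G) : of_vertices n (vertex x g) = (x, g).
Proof.
rewrite /of_vertices vertex0; congr pair; apply: eq_from_tnth => i.
by rewrite tnth_mktuple vertex_ratio.
Qed.

Lemma eq_of_vertices n v v' : (forall i, (i <= n)%N -> v i = v' i) ->
  of_vertices n v = of_vertices n v'.
Proof.
move=> vv; rewrite /of_vertices vv //; congr pair; apply: eq_from_tnth => i.
by rewrite !tnth_mktuple !vv // ltnW.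
Qed.

End Vertices.

Section VertexMaps.
Implicit Types G H K : groupType.

(* (x_0, ..., x_n) |-> (alpha_0(x_{sigma 0}), ..., alpha_m(x_{sigma m})) *)
Definition vertex_map G H (alpha : nat -> G -> H) (sigma : nat -> nat) n m
    (xg : G * n.-tuple G) : H * m.-tuple H :=
  of_vertices m (fun i => alpha i (vertex xg.1 xg.2 (sigma i))).

(** Reindexings compose in the reverse order. The bound on [tau] keeps the second map among the
    vertices 0, ..., m that the intermediate simplex remembers. *)
Lemma vertex_map_comp G H K (alpha : nat -> G -> H) (beta : nat -> H -> K)
    sigma tau n m l : (forall i, (i <= l)%N -> (tau i <= m)%N) ->
  @vertex_map H K beta tau m l \o @vertex_map G H alpha sigma n m =
  vertex_map (fun i => beta i \o alpha (tau i)) (sigma \o tau) l.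
Proof.
move=> tau_le; apply/funext => xg /=; apply: eq_of_vertices => i il.
by rewrite vertex_of_vertices ?tau_le.
Qed.

Lemma eq_vertex_map G H (alpha beta : nat -> G -> H) sigma tau n m :
  (forall i, (i <= m)%N -> alpha i =1 beta i /\ sigma i = tau i) ->
  @vertex_map G H alpha sigma n m = vertex_map beta tau m.
Proof.
move=> e; apply/funext => xg; apply: eq_of_vertices => i /e[ab st].
by rewrite ab st.
Qed.

Lemma vertex_map_id G n : vertex_map (fun=> id) id n = id :> (G * n.-tuple G -> _).
Proof. by apply/funext => -[x g]; rewrite /vertex_map /= of_vertices_vertex. Qed.

Lemma simplex_mapE G H (phi : G -> H) n :
  @simplex_map G H phi n = vertex_map (fun=> phi) id n.
Proof.
apply/funext => -[x g]; rewrite /simplex_map /vertex_map /of_vertices /=.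
by rewrite vertex0.
Qed.

(** [bump i] is the increasing injection that skips i. Omitting an inner vertex merges two
    consecutive ratios into their product, and omitting vertex 0 makes x_1 = g_1^-1 x the new base
    point. *)
Lemma face_vertex_map G n (i : 'I_n.+2) :
  @face G n i = vertex_map (fun=> id) (bump i) n.
Proof.
apply/funext => -[x g]; rewrite /face /vertex_map /of_vertices /= !/bump.
have v1 : vertex x g 1 = ((thead g)^-1 * x)%g.
  by rewrite (vertexS _ _ ord0) vertex0.
congr pair.
  case: ifP => [/eqP->|]; first by rewrite leqn0 v1.
  by rewrite leqn0 => ->; rewrite vertex0.
apply: eq_from_tnth => j; rewrite !tnth_mktuple.
have ga : tnth g (widen_ord (leqnSn n) j) = (vertex x g j * (vertex x g j.+1)^-1)%g.
  by rewrite -(vertex_ratio x).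
have gb : tnth g (lift ord0 j) = (vertex x g j.+1 * (vertex x g j.+2)^-1)%g.
  by rewrite -(vertex_ratio x).
rewrite ga gb; case: (ltngtP j.+1 i) => [ltji|ltij|eqji].
- by rewrite leqNgt (ltn_trans _ ltji) //= leqNgt ltji.
- by rewrite -[(i <= j)%N]ltnS ltij.
- rewrite -eqji ltnn.
  by rewrite -mulgA mulKg.
Qed.

End VertexMaps.

(** * The sign bookkeeping of prism operators *)

Section PrismSum.
Variables (R : pzRingType) (V : lmodType R).
Implicit Types (A B : nat -> nat -> V) (M : nat -> V).

(* A i j stands for the i-th face of the j-th prism simplex, B i j for the j-th
   prism over the i-th face, and M for the intermediate simplices. *)
Lemma prism_sum A B M n :
  (forall i j, (i < j <= n)%N -> A i j = B i j.-1) ->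
  (forall j, (j <= n)%N -> A j j = M j) ->
  (forall j, (j <= n)%N -> A j.+1 j = M j.+1) ->
  (forall i j, (j < i <= n)%N -> A i.+1 j = B i j) ->
  \sum_(i < n.+2) \sum_(j < n.+1) (-1) ^+ (i + j) *: A i j +
  \sum_(i < n.+1) \sum_(j < n) (-1) ^+ (i + j) *: B i j = M 0%N - M n.+1.
Proof.
move=> Alo Adiag Asub Ahi.
pose b i j := (-1) ^+ (i + j) *: B i j.
(* In column j the faces i = j and i = j + 1 have opposite signs and give M j - M j.+1. Every other
   face is a prism over a face, with one index lowered by one and hence the sign changed. *)
have column j : (0 <= j < n.+1)%N ->
    \sum_(0 <= i < n.+2) (-1) ^+ (i + j) *: A i j =
    (M j - M j.+1) - (\sum_(0 <= i < j) b i j.-1 + \sum_(j.+1 <= i < n.+1) b i j).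
  move=> /andP[_ jn]; rewrite ltnS in jn.
  rewrite (@big_cat_nat _ _ _ j) //=; last by rewrite ltnW // ltnW.
  rewrite (@big_cat_nat _ _ _ j.+2 j) //=; last by rewrite ltnW.
  rewrite opprD addrCA; congr (_ + (_ + _)).
  - rewrite big_ltn // big_nat1 Adiag // Asub // addSn exprS mulN1r scaleNr addnn.
    by rewrite -mul2n exprM sqrrN !expr1n !scale1r.
  - rewrite -sumrN; apply: eq_big_nat => i /andP[_ ij].
    rewrite Alo ?ij //; case: j ij {jn} => // j _.
    by rewrite /b addnS exprS mulN1r scaleNr.
  - rewrite big_add1 -sumrN; apply: eq_big_nat => i /andP[ji iin].
    by rewrite Ahi ?ji // /b addSn exprS mulN1r scaleNr.
have -> : \sum_(i < n.+2) \sum_(j < n.+1) (-1) ^+ (i + j) *: A i j =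
    \sum_(0 <= j < n.+1) \sum_(0 <= i < n.+2) (-1) ^+ (i + j) *: A i j.
  by rewrite exchange_big big_mkord; apply: eq_bigr => j _; rewrite big_mkord.
rewrite (eq_big_nat _ _ column) sumrB.
(* The middle terms of the columns telescope to M 0 - M n.+1. *)
rewrite (telescope_sumr_eq (fun j => - M j)); last 2 first.
- by [].
- by move=> k _; rewrite opprK addrC.
rewrite opprK [- _ + M 0%N]addrC -addrA -[RHS]addr0; congr (_ + _).
rewrite addrC; apply/eqP; rewrite subr_eq0; apply/eqP; symmetry.
(* The part i < j is empty for j = 0 and is reindexed by j - 1; the part i > j is empty for j = n.
   For each j < n the two ranges i <= j and i > j then fill 0, ..., n. *)
rewrite big_split /= big_nat_recl // big_geq // add0r.
rewrite [X in _ + X = _]big_nat_recr //= [\sum_(n.+1 <= _ < n.+1) _]big_geq // addr0.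
rewrite -big_split exchange_big big_mkord; apply: eq_bigr => j _ /=.
rewrite -(big_mkord xpredT (fun i => (-1) ^+ (i + j) *: B i j)).
by rewrite [RHS](@big_cat_nat _ _ _ j.+1) // ltnW // ltnS.
Qed.

End PrismSum.

(** * Pushforward along maps with finite fibres *)

Lemma sum_seq_pred1 (T : eqType) (V : nmodType) (r : seq T) (a : T) (f : T -> V) :
  uniq r -> a \in r -> \sum_(x <- r | x == a) f x = f a.
Proof.
move=> ur ar; rewrite big_mkcond (bigD1_seq a) //= eqxx big1 ?addr0 //.
by move=> x /negPf ->.
Qed.

Section Pushforward.
Variables S T : choiceType.

(** Computations with [pushforward] go through a duplicate-free list that may be larger than the
    support on the fibre, so that several functions can share one list. *)
Lemma pushforward_seq (V : nmodType) (h : S -> T) (f : S -> V) y (r : seq S) :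
  uniq r -> (forall x, f x <> 0 -> h x = y -> x \in r) ->
  pushforward h f y = \sum_(x <- r | h x == y) f x.
Proof.
move=> ur fr; rewrite bigfs //; last first.
  by move=> x /eqP hxy; apply: contraNeq => /eqP fx; exact: fr.
by rewrite /pushforward (_ : [set` _] = h @^-1` [set y]) //; apply/seteqP; split=> x /= /eqP.
Qed.

(** Over a fibre with infinite support the sum has the default value 0, which would break additivity
    and functoriality. *)
Definition fibre_finite (V : nmodType) (h : S -> T) (f : S -> V) :=
  forall y, finite_set [set x | f x <> 0 /\ h x = y].

Lemma fibre_finite_seq (V : nmodType) (h : S -> T) (f : S -> V) y :
  fibre_finite h f ->
  exists2 r : seq S, uniq r & forall x, f x <> 0 -> h x = y -> x \in r.
Proof.
move=> /(_ y) fh; exists (finmap.enum_fset (fset_set [set x | f x <> 0 /\ h x = y])).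
  exact: finmap.fset_uniq.
by move=> x fx hx; rewrite in_fset_set //; apply/mem_set.
Qed.

Lemma pushforwardP (R : pzRingType) (V : lmodType R) (h : S -> T) a (f g : S -> V) :
  fibre_finite h f -> fibre_finite h g ->
  pushforward h (a *: f + g) = a *: pushforward h f + pushforward h g.
Proof.
move=> ff fg; apply/funext => y.
have [r ur fr] := fibre_finite_seq y ff; have [s us gs] := fibre_finite_seq y fg.
pose t := undup (r ++ s); have ut : uniq t by exact: undup_uniq.
have ft x : f x <> 0 -> h x = y -> x \in t.
  by move=> fx hx; rewrite mem_undup mem_cat fr.
have gt x : g x <> 0 -> h x = y -> x \in t.
  by move=> gx hx; rewrite mem_undup mem_cat gs ?orbT.
rewrite (@pushforward_seq _ _ _ _ t) //; last first.
  move=> x fgx hx; have [fx0|/ft->//] := pselect (f x = 0).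
  apply: gt => // gx0; apply: fgx.
  by rewrite -[LHS]/(a *: f x + g x) fx0 gx0 scaler0 addr0.
rewrite -[RHS]/(a *: pushforward h f y + pushforward h g y).
by rewrite !(@pushforward_seq _ _ _ _ t) // scaler_sumr -big_split.
Qed.

End Pushforward.

(** The sum over the support in a fibre of the composite is grouped by the value of [h]. Finiteness
    for the composite covers the inner sums, whose fibres are contained in its own. *)
Lemma pushforward_comp (S T U : choiceType) (V : nmodType) (h : S -> T) (k : T -> U) (f : S -> V) :
  fibre_finite (k \o h) f ->
  pushforward k (pushforward h f) = pushforward (k \o h) f.
Proof.
move=> fkh; apply/funext => z; have [r ur fr] := fibre_finite_seq z fkh.
rewrite (pushforward_seq ur fr).
have hr y : k y = z -> pushforward h f y = \sum_(x <- r | h x == y) f x.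
  move=> ky; apply: pushforward_seq => // x fx hx; apply: fr => //=.
  by rewrite hx.
(* Over z the outer sum is supported in the image of the list [r] under [h]. *)
rewrite (@pushforward_seq _ _ _ _ _ _ (undup (map h r))) ?undup_uniq //; last first.
  move=> y fy ky; apply: contrapT => /negP yr; apply: fy; rewrite hr //.
  rewrite big1_seq // => x /andP[/eqP hx xr]; case/negP: yr.
  by rewrite mem_undup -hx map_f.
under eq_bigr => y /eqP ky do rewrite hr //.
rewrite (exchange_big_dep (fun x => (k \o h) x == z)) /=; last first.
  by move=> y x /eqP <- /eqP ->.
rewrite big_seq_cond [RHS]big_seq_cond; apply: eq_bigr => x /andP[xr /eqP khx].
rewrite -[RHS](@sum_seq_pred1 _ _ (undup (map h r)) (h x) (fun=> f x)).
- apply: eq_bigl => y; rewrite [RHS]eq_sym; case: (eqVneq (h x) y) => [<-|_]; last by rewrite andbF.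
  by rewrite andbT; apply/eqP.
- exact: undup_uniq.
- by rewrite mem_undup map_f.
Qed.

(** * Vertex maps acting on chains and cochains *)

Lemma finite_range_tuple (X T : Type) n (f : 'I_n -> X -> T) :
  (forall i, finite_set (range (f i))) ->
  finite_set (range (fun x => [tuple f i x | i < n])).
Proof.
elim: n f => [f _|n IH f ff].
  by apply: (sub_finite_set _ (finite_set1 [tuple])) => t _; exact: tuple0.
apply: sub_finite_set (finite_image11 (fun a (t : n.-tuple T) => [tuple of a :: t])
  (ff ord0) (IH (fun i => f (lift ord0 i)) (fun i => ff _))).
move=> _ [x _ <-]; exists x => //; apply: eq_from_tnth => i; rewrite tnth_mktuple.
by have [j ->|->] := unliftP ord0 i; rewrite ?tnthS ?tnth0 // tnth_mktuple.
Qed.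

Section CoherentFamilies.
Variables G H : groupType.

(** With a and b the vertices of a fixed tuple based at 1, these are the ratios of the vertices of
    the image. Different indices i and j occur because prisms mix the identity with another map. *)
Definition coherent (alpha : nat -> G -> H) :=
  forall i j a b, finite_set (range (fun x => alpha i (a * x) * (alpha j (b * x))^-1)%g).

Lemma vertex_map_tuple_finite alpha sigma n m (g : n.-tuple G) : coherent alpha ->
  finite_set (range (fun x => (vertex_map alpha sigma m (x, g)).2)).
Proof.
move=> ca; apply: finite_range_tuple => i /=.
apply: sub_finite_set (ca i i.+1 (vertex 1 g (sigma i)) (vertex 1 g (sigma i.+1)))%g.
by move=> _ [x _ <-]; exists x => //; rewrite -!vertex_shift.
Qed.

End CoherentFamilies.

Section PartialTransfer.
Variables (G H : groupType) (V : nmodType).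

(** The operator f |-> phi_*(1_A f): [patch] with default 0 multiplies by the indicator function of
    A. *)
Definition push_on (phi : G -> H) (A : set G) (f : G -> V) : H -> V :=
  pushforward phi (patch (fun=> 0) A f).

Definition pull_on (phi : G -> H) (A : set G) (f : H -> V) : G -> V := patch (fun=> 0) A (f \o phi).

Lemma push_on0 phi (f : G -> V) : push_on phi set0 f = fun=> 0.
Proof.
apply/funext => y; rewrite /push_on /pushforward fsbig1 // => x _.
by rewrite /patch in_set0.
Qed.

End PartialTransfer.

Section PushChains.
Variables (R : comPzRingType) (W : lmodType R) (G H : groupType).
Variables (LG : coefficients W G) (LH : coefficients W H).

Definition finite_fibres (phi : G -> H) := forall y, finite_set (phi @^-1` [set y]).

Definition push_stable (phi : G -> H) := forall (A : set G) (f : G -> W),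
  submod_set LG f -> submod_set LH (push_on phi A f).

Variables (alpha : nat -> G -> H) (sigma : nat -> nat).
Hypothesis fib : finite_fibres (alpha 0).

(** For a point (x, g) of the support over (y, h), the tuple g is one of finitely many. The vertex
    of index [sigma 0] lies in the finite fibre of [alpha 0] over y, and together with g it
    determines x. Here [sigma 0] may differ from 0, as it does for face 0. *)
Lemma chain_fibre_finite n m (c : G * n.-tuple G -> W) :
  chain_set LG c -> fibre_finite (vertex_map alpha sigma m) c.
Proof.
move=> [_ fc] [y h].
have := finite_setX (fib y) fc.
move=> /(finite_image (fun zg => ((vertex 1 zg.2 (sigma 0))^-1 * zg.1, zg.2)%g)).
apply: sub_finite_set => -[x g] /= [cxg [e _]].
exists ((vertex 1 g (sigma 0) * x)%g, g) => /=; last by rewrite mulKg.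
split; first by rewrite -vertex_shift.
by move=> /(congr1 (@^~ x)).
Qed.

Hypothesis sigma0 : sigma 0 = 0%N.

(** As [sigma] fixes 0, the first coordinate of the image is [alpha 0 x]; prescribing the image
    tuple h only cuts out a set of x for each g. The list [r] may be chosen from the chain, or from
    h alone as continuity requires. *)
Lemma slice_pushforward n m (c : G * n.-tuple G -> W) h (r : seq (n.-tuple G)) :
  uniq r ->
  (forall x g, c (x, g) <> 0 -> (vertex_map alpha sigma m (x, g)).2 = h -> g \in r) ->
  slice (pushforward (vertex_map alpha sigma m) c) h =
  \sum_(g <- r) push_on (alpha 0%N)
    [set x | (vertex_map alpha sigma m (x, g)).2 = h] (slice c g).
Proof.
move=> ur rP; apply/funext => y; rewrite fct_sumE /slice.
pose s := finmap.enum_fset (fset_set (alpha 0 @^-1` [set y])).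
have us : uniq s by exact: finmap.fset_uniq.
have sP x : alpha 0 x = y -> x \in s.
  by move=> xy; rewrite in_fset_set //; apply/mem_set.
rewrite (@pushforward_seq _ _ _ _ _ _ [seq (x, g) | x <- s, g <- r]); first last.
- move=> [x g] cxg [/= xy gh]; apply/allpairsP; exists (x, g); split=> //=.
    by apply: sP; rewrite -xy sigma0 vertex0.
  by apply: (rP x) => //=; rewrite -gh.
- by apply: allpairs_uniq => // -[x g] [x' g'] _ _ [-> ->].
rewrite big_mkcond big_allpairs exchange_big; apply: eq_bigr => g _.
rewrite /push_on (@pushforward_seq _ _ _ _ _ _ s) //; last by move=> x _ /sP.
rewrite [RHS]big_mkcond; apply: eq_bigr => x _.
rewrite -[vertex_map _ _ _ _ == _]/((_ == _) && (_ == _)) /= sigma0 vertex0.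
case: ifPn => [/andP[-> /eqP gh]|]; first by rewrite /patch mem_set.
case: ifP => //= _ ne; rewrite /patch; case: ifPn => // /set_mem /= gh.
by move: ne; rewrite -gh eqxx.
Qed.

Lemma pushforward_chain n m (c : G * n.-tuple G -> W) :
  coherent alpha -> push_stable (alpha 0) ->
  chain_set LG c -> chain_set LH (pushforward (@vertex_map G H alpha sigma n m) c).
Proof.
move=> ca sa cc; have [r ur rc] := chain_support cc; have [Lc _] := cc.
have sE h := @slice_pushforward n m c h r ur.
have rP h x g : c (x, g) <> 0 -> (vertex_map alpha sigma m (x, g)).2 = h -> g \in r.
  by move=> cxg _; apply: contrapT => /negP /rc /(congr1 (@^~ x)).
split=> [h|].
  by rewrite (sE _ (rP h)); apply: Defs.coef_sum => g _; apply: sa; exact: Lc.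
(* A nonzero slice of the image lies over an image tuple of some g in [r], and by coherence each g
   has finitely many of these. *)
apply: (@sub_finite_set _ _ (\bigcup_(g in [set` r])
  (range (fun x => (vertex_map alpha sigma m (x, g)).2)))); last first.
  by apply: bigcup_finite => // g _; exact: vertex_map_tuple_finite.
move=> h /= h0; apply: contrapT => nh; apply: h0; rewrite (sE _ (rP h)).
rewrite big1_seq // => g /andP[_ gr]; rewrite (_ : [set x | _] = set0) ?push_on0 //.
apply/seteqP; split=> x //= gh; apply: nh; exists g => //.
by exists x.
Qed.

End PushChains.

Section PullCochains.
Variables (R : comPzRingType) (W : lmodType R) (G H : groupType).
Variables (LG : coefficients W G) (LH : coefficients W H).

Definition pull_stable (phi : G -> H) := forall (A : set G) (f : H -> W),
  submod_set LH f -> submod_set LG (pull_on phi A f).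

Variables (alpha : nat -> G -> H) (sigma : nat -> nat).
Hypothesis sigma0 : sigma 0 = 0%N.

(** The sets indexed by the list [r] partition the group, so exactly one summand survives at each x.
    Coherence supplies such a finite list. *)
Lemma slice_pullback n m (c : H * m.-tuple H -> W) g (r : seq (m.-tuple H)) :
  uniq r -> (forall x, (@vertex_map G H alpha sigma n m (x, g)).2 \in r) ->
  slice (c \o vertex_map alpha sigma m) g =
  \sum_(h <- r) pull_on (alpha 0%N)
    [set x | (vertex_map alpha sigma m (x, g)).2 = h] (slice c h).
Proof.
move=> ur rP; apply/funext => x; rewrite fct_sumE /slice /=.
rewrite -(sum_seq_pred1 (fun=> c (vertex_map alpha sigma m (x, g))) ur (rP x)).
rewrite [LHS]big_mkcond; apply: eq_bigr => h _; rewrite /pull_on /patch.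
case: eqP => [->|ne].
  rewrite mem_set //= /vertex_map /of_vertices /=.
  by rewrite sigma0 vertex0.
by rewrite memNset //= => gh; apply: ne.
Qed.

Lemma pullback_cochain n m (c : H * m.-tuple H -> W) :
  coherent alpha -> pull_stable (alpha 0%N) -> cochain_set LH c ->
  cochain_set LG (c \o @vertex_map G H alpha sigma n m).
Proof.
move=> ca sa Lc g; have fg := vertex_map_tuple_finite sigma m g ca.
rewrite (@slice_pullback _ _ _ _ (finmap.enum_fset (fset_set
    (range (fun x => (vertex_map alpha sigma m (x, g)).2))))).
- by apply: Defs.coef_sum => h _; apply: sa; exact: Lc.
- exact: finmap.fset_uniq.
- by move=> x; rewrite in_fset_set //; apply/mem_set; exists x.
Qed.

End PullCochains.

Section FibreFiniteSums.
Variables (R : pzRingType) (V : lmodType R) (S T : choiceType) (h : S -> T).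
Implicit Types f g : S -> V.

Lemma fibre_finite0 : fibre_finite h (0 : S -> V).
Proof.
by move=> y; rewrite (_ : [set x | _] = set0) //; apply/seteqP; split=> x //= [].
Qed.

Lemma fibre_finiteP a f g :
  fibre_finite h f -> fibre_finite h g -> fibre_finite h (a *: f + g).
Proof.
move=> ff fg y.
apply: (@sub_finite_set _ _ ([set x | f x <> 0 /\ h x = y] `|` [set x | g x <> 0 /\ h x = y])).
  move=> x /= [fgx hx]; have [fx|fx] := pselect (f x = 0); last by left.
  right; split=> // gx; apply: fgx.
  by rewrite -[LHS]/(a *: f x + g x) fx gx scaler0 addr0.
by rewrite finite_setU.
Qed.

Lemma pushforward0 : pushforward h (0 : S -> V) = 0.
Proof. by apply/funext => y; rewrite /pushforward fsbig1. Qed.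

Lemma pushforward_sum (I : Type) (r : seq I) (a : I -> R) (f : I -> S -> V) :
  (forall i, fibre_finite h (f i)) ->
  pushforward h (\sum_(i <- r) a i *: f i) = \sum_(i <- r) a i *: pushforward h (f i).
Proof.
move=> ff; suff [] : fibre_finite h (\sum_(i <- r) a i *: f i) /\
  pushforward h (\sum_(i <- r) a i *: f i) = \sum_(i <- r) a i *: pushforward h (f i) by [].
elim: r => [|i r [IHf IH]].
  by rewrite !big_nil pushforward0; split=> //; exact: fibre_finite0.
by rewrite !big_cons pushforwardP // IH; split=> //; exact: fibre_finiteP.
Qed.

End FibreFiniteSums.

(** * Homotopy invariance *)

Section SubquotientIso.
Variables (R : pzRingType) (V V' : lmodType R) (Z B : submodule V) (Z' B' : submodule V').

Section Induced.
Variables (F : V -> V') (linF : linear F).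
Hypothesis FZ : forall z, submod_set Z z -> submod_set Z' (F z).
Hypothesis FB : forall z, submod_set B z -> submod_set B' (F z).

Definition induced_map (x : subquotient Z B) : subquotient Z' B' :=
  subq_class B' (mk_submod (FZ (submodE (projT1 (cid (subq_class_surj x)))))).

Lemma induced_mapE (z : submod_type Z) :
  induced_map (subq_class B z) = subq_class B' (mk_submod (FZ (submodE z))).
Proof.
rewrite /induced_map; case: cid => z' /= zz'.
apply/subq_classE => /=; have /subq_classE/FB := esym zz'.
by rewrite [X in F X]addrC -scaleN1r linF scaleN1r addrC.
Qed.

Lemma induced_map_linear : linear induced_map.
Proof.
move=> a x y; have [z ->] := subq_class_surj x; have [t ->] := subq_class_surj y.
rewrite -subq_class_is_linear !induced_mapE -subq_class_is_linear; congr subq_class.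
by apply: val_inj; rewrite /= linF.
Qed.

End Induced.

(** The map induced by [K] is inverse to the one induced by [F], because both composites differ from
    the identity by elements of [B] and [B']. *)
Lemma induces_isoI (r : V -> V' -> Prop) (F : V -> V') (K : V' -> V) :
  linear F -> linear K -> (forall c, r c (F c)) ->
  (forall z, submod_set Z z -> submod_set Z' (F z)) ->
  (forall z, submod_set B z -> submod_set B' (F z)) ->
  (forall z, submod_set Z' z -> submod_set Z (K z)) ->
  (forall z, submod_set B' z -> submod_set B (K z)) ->
  (forall z, submod_set Z z -> submod_set B (K (F z) - z)) ->
  (forall z, submod_set Z' z -> submod_set B' (F (K z) - z)) ->
  induces_iso Z B Z' B' r.
Proof.
move=> linF linK rF FZ FB KZ KB KF FK; split=> [c|]; first by exists (F c).
pose f : {linear subquotient Z B -> subquotient Z' B'} :=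
  HB.pack (induced_map FZ)
    (GRing.isLinear.Build R (subquotient Z B) (subquotient Z' B') *:%R
      (induced_map FZ) (induced_map_linear linF FZ FB)).
have fE z : f (subq_class B z) = subq_class B' (mk_submod (FZ _ (submodE z))).
  exact: (induced_mapE linF).
exists f; split; last by move=> z; exists (mk_submod (FZ _ (submodE z))).
pose g (x' : subquotient Z' B') := subq_class B
  (mk_submod (KZ _ (submodE (projT1 (cid (subq_class_surj x')))))).
exists g => x.
  have [z ->] := subq_class_surj x; rewrite fE /g; case: cid => z' /= zz'.
  apply/subq_classE => /=; have /subq_classE/KB := esym zz' => /= h.
  (* z' is the representative chosen for the class of F z, so K z' - z = K (z' - F z) + (K (F z) -
     z) has both terms in [B]. *)
  have -> : K (submod_val z') - submod_val z =
      1 *: K (submod_val z' - F (submod_val z)) + (K (F (submod_val z)) - submod_val z).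
    have -> u v : K (u - v) = K u - K v by rewrite addrC -scaleN1r linK scaleN1r addrC.
    by rewrite scale1r addrA subrK.
  by apply: submodP => //; apply: KF; exact: submodE.
have [z ->] := subq_class_surj x; rewrite /g; case: cid => z' /= ->.
by rewrite (induced_mapE linF _ FB); apply/subq_classE => /=; apply: FK; exact: submodE.
Qed.

End SubquotientIso.

Section Prism.
Variables (G : groupType) (k : G -> G).

(* (x_0, ..., x_n) |-> (x_0, ..., x_j, k(x_j), ..., k(x_n)) *)
Definition prism n j : G * n.-tuple G -> G * n.+1.-tuple G :=
  vertex_map (fun i => if (i <= j)%N then id else k)
    (fun i => if (i <= j)%N then i else i.-1) n.+1.

(** The j-th prism over the i-th face, in a form that also makes sense for n = 0, where there are no
    faces and the sum over j < n is empty. *)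
Definition prism_face n j i : G * n.-tuple G -> G * n.-tuple G :=
  vertex_map (fun l => if (l <= j)%N then id else k)
    (fun l => bump i (if (l <= j)%N then l else l.-1)) n.

Lemma prism_faceE n j (i : 'I_n.+2) : (j <= n)%N ->
  @prism_face n.+1 j i = @prism n j \o face i.
Proof.
move=> jn; rewrite face_vertex_map /prism vertex_map_comp //.
by move=> l ln; case: ifP; lia.
Qed.

(** An arbitrary [Phi] lets one identity serve both variances: pushing a chain forward along a map,
    and composing a cochain with it. *)
Lemma prism_map_sum (R : pzRingType) (V : lmodType R) n
    (Phi : (G * n.-tuple G -> G * n.-tuple G) -> V) :
  \sum_(i < n.+2) \sum_(j < n.+1) (-1) ^+ (i + j) *: Phi (face i \o prism j) +
  \sum_(i < n.+1) \sum_(j < n) (-1) ^+ (i + j) *: Phi (prism_face j i) =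
  Phi (@simplex_map G G k n) - Phi id.
Proof.
pose A i j := @vertex_map G G (fun=> id) (bump i) n.+1 n \o prism j.
(* [M j] applies [k] to the vertices from j on; it runs from the map induced by [k] at j = 0 to the
   identity at j = n + 1. *)
pose M j := @vertex_map G G (fun i => if (i < j)%N then id else k) id n n.
have AE i j : A i j =
    vertex_map (fun l => if (bump i l <= j)%N then id else k)
      (fun l => if (bump i l <= j)%N then bump i l else (bump i l).-1) n.
  rewrite /A /prism vertex_map_comp; last by rewrite /bump; lia.
  by apply: eq_vertex_map => l ln; split=> // x /=; case: ifP.
have kE (b c : bool) x : b = c -> (if b then id else k) x = (if c then id else k) x.
  by move=> ->.
have := @prism_sum R V (fun i j => Phi (A i j)) (fun i j => Phi (prism_face j i))
  (fun j => Phi (M j)) n.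
have -> : M 0%N = @simplex_map G G k n by rewrite simplex_mapE.
have -> : M n.+1 = id.
  rewrite -(@vertex_map_id G n); apply: eq_vertex_map => i il.
  by split=> // x; rewrite ltnS il.
move=> <-.
- congr (_ + _); apply: eq_bigr => i _; apply: eq_bigr => j _.
  by rewrite face_vertex_map.
- move=> i j ij; congr Phi; rewrite AE; apply: eq_vertex_map => l ln.
  split=> [x|]; last by rewrite /bump; do 2 case: ifP; lia.
  by apply: kE; rewrite /bump; lia.
- move=> j jn; congr Phi; rewrite AE; apply: eq_vertex_map => l ln.
  split=> [x|]; last by rewrite /bump; case: ifP; lia.
  by apply: kE; rewrite /bump; lia.
- move=> j jn; congr Phi; rewrite AE; apply: eq_vertex_map => l ln.
  split=> [x|]; last by rewrite /bump; case: ifP; lia.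
  by apply: kE; rewrite /bump; lia.
- move=> i j ij; congr Phi; rewrite AE; apply: eq_vertex_map => l ln.
  split=> [x|]; last by rewrite /bump; do 2 case: ifP; lia.
  by apply: kE; rewrite /bump; lia.
Qed.

End Prism.

Lemma simplex_map_comp (G H K : groupType) (phi : G -> H) (psi : H -> K) n :
  @simplex_map H K psi n \o @simplex_map G H phi n = @simplex_map G K (psi \o phi) n.
Proof. by rewrite !simplex_mapE vertex_map_comp. Qed.

Lemma face_simplex_map (G H : groupType) (phi : G -> H) n (i : 'I_n.+2) :
  face i \o @simplex_map G H phi n.+1 = @simplex_map G H phi n \o face i.
Proof.
rewrite !simplex_mapE !face_vertex_map !vertex_map_comp //.
by move=> l ln; rewrite /bump; lia.
Qed.

Section ChainMap.
Variables (R : comPzRingType) (W : lmodType R) (G H : groupType) (phi : G -> H).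
Variables (LG : coefficients W G) (LH : coefficients W H).
Hypothesis fib : finite_fibres phi.
Hypothesis coh : coherent (fun=> phi).

Lemma simplex_map_fibre_finite n (c : G * n.-tuple G -> W) :
  chain_set LG c -> fibre_finite (@simplex_map G H phi n) c.
Proof. by rewrite simplex_mapE; exact: chain_fibre_finite. Qed.

Lemma face_simplex_map_fibre_finite n (i : 'I_n.+2) (c : G * n.+1.-tuple G -> W) :
  chain_set LG c -> fibre_finite (face i \o @simplex_map G H phi n.+1) c.
Proof.
rewrite simplex_mapE face_vertex_map vertex_map_comp; first exact: chain_fibre_finite.
by move=> l ln; rewrite /bump; lia.
Qed.

Hypothesis stab : push_stable LG LH phi.

Lemma pushforward_simplex_chain n (c : G * n.-tuple G -> W) :
  chain_set LG c -> chain_set LH (pushforward (@simplex_map G H phi n) c).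
Proof. by rewrite simplex_mapE; exact: pushforward_chain. Qed.

Definition push_chains n (c : chains LG n) : chains LH n :=
  @mk_submod _ _ (chain_submod LH n) _ (pushforward_simplex_chain (submodE c)).

Lemma push_chains_linear n : linear (@push_chains n).
Proof.
move=> a u v; apply: val_inj => /=.
by rewrite -pushforwardP //;
  [exact: simplex_map_fibre_finite (submodE u) | exact: simplex_map_fibre_finite (submodE v)].
Qed.

Lemma push_chains_boundary n (c : chains LG n.+1) :
  push_chains (boundary c) = boundary (push_chains c).
Proof.
apply: val_inj => /=; rewrite /boundary_fun pushforward_sum => [|i]; last first.
  exact: (simplex_map_fibre_finite (pushforward_face_chain i (submodE c))).
apply: eq_bigr => i _; have cc := submodE c.
have ff := face_simplex_map_fibre_finite i cc.
by rewrite !pushforward_comp ?face_simplex_map // -face_simplex_map.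
Qed.

Lemma push_cycles n (c : chains LG n) :
  submod_set (cycles LG n) c -> submod_set (cycles LH n) (push_chains c).
Proof.
case: n c => //= n c dc0; rewrite -push_chains_boundary dc0.
have := push_chains_linear (-1) 0 (0 : chains LG n).
by rewrite scaler0 addr0 scaleN1r addNr.
Qed.

Lemma push_boundaries n (c : chains LG n) :
  submod_set (boundaries LG n) c -> submod_set (boundaries LH n) (push_chains c).
Proof. by move=> [b _ <-]; exists (push_chains b); rewrite ?push_chains_boundary. Qed.

End ChainMap.

Section CochainMap.
Variables (R : comPzRingType) (W : lmodType R) (G H : groupType) (phi : G -> H).
Variables (LG : coefficients W G) (LH : coefficients W H).
Hypothesis coh : coherent (fun=> phi).
Hypothesis stab : pull_stable LG LH phi.

Lemma pullback_simplex_cochain n (c : H * n.-tuple H -> W) :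
  cochain_set LH c -> cochain_set LG (c \o @simplex_map G H phi n).
Proof. by rewrite simplex_mapE; exact: pullback_cochain. Qed.

Definition pull_cochains n (c : cochains LH n) : cochains LG n :=
  @mk_submod _ _ (cochain_submod LG n) _ (pullback_simplex_cochain (submodE c)).

Lemma pull_cochains_linear n : linear (@pull_cochains n).
Proof. by move=> a u v; apply: val_inj. Qed.

Lemma pull_cochains_coboundary n (c : cochains LH n) :
  pull_cochains (coboundary c) = coboundary (pull_cochains c).
Proof.
apply: val_inj => /=; rewrite /coboundary_fun; apply/funext => x /=.
rewrite !fct_sumE; apply: eq_bigr => i _.
rewrite -[LHS]/((-1) ^+ i *: submod_val c ((face i \o @simplex_map G H phi n.+1) x)).
by rewrite face_simplex_map.
Qed.

Lemma pull_cocycles n (c : cochains LH n) :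
  submod_set (cocycles LH n) c -> submod_set (cocycles LG n) (pull_cochains c).
Proof.
move=> /= dc0; rewrite -pull_cochains_coboundary dc0.
by apply: val_inj.
Qed.

Lemma pull_coboundaries n (c : cochains LH n) :
  submod_set (coboundaries LH n) c -> submod_set (coboundaries LG n) (pull_cochains c).
Proof.
case: n c => [c -> /=|n c [b _ <-]]; first by apply: val_inj.
by exists (pull_cochains b); rewrite ?pull_cochains_coboundary.
Qed.

End CochainMap.

Section PrismHomotopy.
Variables (R : comPzRingType) (W : lmodType R) (G : groupType) (k : G -> G).
Variable L : coefficients W G.
Hypothesis coh : forall P : pred nat, coherent (fun i => if P i then id else k).
Hypothesis fib : finite_fibres k.

(** With T the alternating sum of the prisms, d T + T d = k_* - 1, so on a cycle the difference is
    the boundary of T c. Every prism is the identity on vertex 0, so stability under [id] puts T c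
    among the chains. *)
Lemma chain_homotopy n (c : chains L n) :
  push_stable L L id -> submod_set (cycles L n) c ->
  exists2 b : chains L n, submod_set (boundaries L n) b &
    submod_val b = pushforward (@simplex_map G G k n) (submod_val c) - submod_val c.
Proof.
move=> stab zc; have cc := submodE c.
have fid : finite_fibres (id : G -> G) by move=> y; exact: finite_set1.
have fibk (b : bool) : finite_fibres (if b then id else k) by case: b.
have Pc j : chain_set L (pushforward (@prism G k n j) (submod_val c)).
  by apply: (@pushforward_chain _ _ _ _ L L (fun i => if (i <= j)%N then id else k)).
have Tc : chain_set L (\sum_(j < n.+1) (-1) ^+ j *: pushforward (@prism G k n j) (submod_val c)).
  elim/big_ind: _ => [|u v cu cv|j _]; first exact: chain_set0.
    by rewrite -[u]scale1r; exact: chain_setP.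
  rewrite -[_ *: _]addr0; exact: chain_setP (Pc j) (chain_set0 L n.+1).
exists (boundary (mk_submod (Tc : submod_set (chain_submod L n.+1) _))).
  by exists (mk_submod (Tc : submod_set (chain_submod L n.+1) _)).
have := @prism_map_sum G k _ _ n (fun h => pushforward h (submod_val c)).
(* The second sum is T (d c): empty in degree 0, and zero otherwise because c is a cycle. *)
rewrite [X in _ + X = _](_ : _ = 0) ?addr0; last first.
  case: n c zc cc {Tc Pc} => [|n] c zc cc.
    by rewrite big1 // => i _; rewrite big_ord0.
  rewrite exchange_big big1 // => j _.
  transitivity ((-1) ^+ j *: pushforward (@prism G k n j) (boundary_fun (submod_val c))).
    rewrite /boundary_fun pushforward_sum => [|i]; last first.
      apply: (@chain_fibre_finite _ _ _ _ L) => //; exact: pushforward_face_chain.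
    rewrite scaler_sumr; apply: eq_bigr => i _.
    rewrite scalerA -exprD addnC prism_faceE ?pushforward_comp // -1?ltnS //.
    by rewrite -prism_faceE -1?ltnS //; exact: (@chain_fibre_finite _ _ _ _ L).
  have -> : boundary_fun (submod_val c) = 0 by have := congr1 (@submod_val _ _ _) zc.
  by rewrite pushforward0 scaler0.
rewrite (_ : pushforward id _ = submod_val c) => [<-|]; last first.
  apply/funext => x; rewrite (@pushforward_seq _ _ _ _ _ _ [:: x]) //.
    by rewrite big_cons big_nil eqxx addr0.
  by move=> y _ <-; exact: mem_head.
apply: eq_bigr => i _; rewrite pushforward_sum => [|j]; last first.
  by rewrite face_vertex_map; exact: chain_fibre_finite (Pc j).
rewrite scaler_sumr; apply: eq_bigr => j _.
rewrite scalerA -exprD pushforward_comp // face_vertex_map /prism vertex_map_comp.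
  apply: chain_fibre_finite cc; exact: fibk.
by move=> l ln; rewrite /bump; lia.
Qed.

(** Dually, the faces of prisms now give the coboundary of c composed with prisms, which vanishes,
    and the prisms over faces give the coboundary of T c. *)
Lemma cochain_homotopy n (c : cochains L n) :
  pull_stable L L id -> submod_set (cocycles L n) c ->
  exists2 b : cochains L n, submod_set (coboundaries L n) b &
    submod_val b = submod_val c \o @simplex_map G G k n - submod_val c.
Proof.
move=> stab zc.
have := @prism_map_sum G k _ _ n (fun h => submod_val c \o h).
rewrite [X in X + _ = _](_ : _ = 0) ?add0r; last first.
  rewrite exchange_big big1 // => j _.
  transitivity ((-1) ^+ j *: (coboundary_fun (submod_val c) \o @prism G k n j)).
    rewrite /coboundary_fun; apply/funext => x.
    rewrite fct_sumE -[RHS]/((-1) ^+ j *: ((\sum_i _) _)) fct_sumE scaler_sumr.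
    by apply: eq_bigr => i _; rewrite addnC exprD -scalerA.
  have -> : coboundary_fun (submod_val c) = 0 by have := congr1 (@submod_val _ _ _) zc.
  by apply/funext => x; exact: scaler0.
case: n c zc => [|n] c zc.
  rewrite big1 => [e|i _]; last by rewrite big_ord0.
  by exists 0.
have Tc : cochain_set L (\sum_(j < n.+1) (-1) ^+ j *: (submod_val c \o @prism G k n j)).
  elim/big_ind: _ => [|u v cu cv|j _]; first exact: (submod0 (cochain_submod L n)).
    by rewrite -[u]scale1r; exact: cochain_setP.
  rewrite -[_ *: _]addr0; apply: cochain_setP; last exact: (submod0 (cochain_submod L n)).
  exact: pullback_cochain (submodE c).
pose b : cochains L n := mk_submod (Tc : submod_set (cochain_submod L n) _).
move=> e; exists (coboundary b); first by exists b.
rewrite -[submod_val c in RHS]/(submod_val c \o id) -e.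
rewrite /= /coboundary_fun; apply: eq_bigr => i _; apply/funext => x.
rewrite -[LHS]/((-1) ^+ i *: ((\sum_j _) _)) !fct_sumE scaler_sumr.
apply: eq_bigr => j _; rewrite prism_faceE // -1?ltnS //.
by rewrite exprD -scalerA.
Qed.

End PrismHomotopy.

(** * Coarse maps and transfers of values *)

Section Transfers.
Variables X Y : Type.

Definition partial_function (rho : X -> Y -> Prop) :=
  forall x y y', rho x y -> rho x y' -> y = y'.

(** Since [rho] is functional from X to Y, distinct points where v is nonzero take their values from
    distinct points of X. No value of u is used twice, and norms cannot grow. *)
Definition carries (V : nmodType) (rho : X -> Y -> Prop) (u : X -> V) (v : Y -> V) :=
  partial_function rho /\ forall y, v y = 0 \/ exists2 x, rho x y & v y = u x.

End Transfers.

Definition transfer_stable (R : comPzRingType) (W : lmodType R) (G H : groupType)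
    (LG : coefficients W G) (LH : coefficients W H) (rel : G -> H -> Prop) :=
  forall rho u v, (forall x y, rho x y -> rel x y) -> carries rho u v ->
    submod_set LG u -> submod_set LH v.

Section Separation.
Variables (G H : groupType) (phi : G -> H) (e : G -> G).

Definition separates := finite_set (range e) /\
  forall x x', phi x = phi x' -> e x = e x' -> x = x'.

Definition separation_pieces : seq G := finmap.enum_fset (fset_set (range e)).

Lemma patch_split (V : nmodType) A (f : G -> V) : separates ->
  patch (fun=> 0) A f =
  \sum_(a <- separation_pieces) (patch (fun=> 0) (A `&` e @^-1` [set a]) f : G -> V).
Proof.
move=> [fe _]; apply/funext => x; rewrite fct_sumE.
have ex : e x \in separation_pieces by rewrite in_fset_set //; apply/mem_set; exists x.
rewrite -(sum_seq_pred1 (fun=> patch (fun=> 0) A f x) (finmap.fset_uniq _) ex).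
rewrite big_mkcond; apply: eq_bigr => a _; rewrite /patch in_setI.
have -> : (x \in e @^-1` [set a]) = (a == e x).
  by apply/idP/eqP => [/set_mem //|->]; apply/mem_set.
by rewrite andbC; case: eqP.
Qed.

Lemma pull_on_split (V : nmodType) A (f : H -> V) : separates ->
  pull_on phi A f =
  \sum_(a <- separation_pieces) pull_on phi (A `&` e @^-1` [set a]) f.
Proof. exact: patch_split. Qed.

Lemma push_on_split (R : pzRingType) (V : lmodType R) A (f : G -> V) :
  separates -> finite_fibres phi ->
  push_on phi A f =
  \sum_(a <- separation_pieces) push_on phi (A `&` e @^-1` [set a]) f.
Proof.
move=> se fib; rewrite /push_on patch_split //.
under eq_bigr => a _ do rewrite -[patch _ _ _]scale1r.
rewrite pushforward_sum => [|a y]; last by apply: sub_finite_set (fib y) => x [].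
by apply: eq_bigr => a _; rewrite scale1r.
Qed.

(** A fibre of [phi] meets A in at most one point, so the sum over it has at most one nonzero
    term. *)
Lemma push_on_carries (V : nmodType) A (f : G -> V) :
  (forall x x', A x -> A x' -> phi x = phi x' -> x = x') ->
  carries (fun x y => phi x = y) f (push_on phi A f).
Proof.
move=> injA; split=> [x y y' -> //|y].
have [[x Ax <-]|nA] := pselect (exists2 x, A x & phi x = y).
  right; exists x => //; rewrite /push_on (@pushforward_seq _ _ _ _ _ _ [:: x]) //.
    by rewrite big_cons big_nil eqxx addr0 /patch mem_set.
  move=> x'; rewrite /patch; case: ifPn => // /set_mem Ax' _ xx'.
  by rewrite (injA x' x) ?mem_head.
left; rewrite /push_on /pushforward fsbig1 // => x /= xy; rewrite /patch.
by case: ifPn => // /set_mem Ax; case: nA; exists x.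
Qed.

(** Here values move along the converse of [phi], which becomes a partial function once it is cut
    down to A. *)
Lemma pull_on_carries (V : nmodType) A (f : H -> V) :
  (forall x x', A x -> A x' -> phi x = phi x' -> x = x') ->
  carries (fun y x => A x /\ phi x = y) f (pull_on phi A f).
Proof.
move=> injA; split=> [y x x' [Ax <-] [Ax' e']|x]; first exact: injA.
rewrite /pull_on /patch; case: ifPn => [/set_mem Ax|]; last by left.
by right; exists (phi x).
Qed.

Lemma separation_inj (A : set G) a : separates ->
  forall x x', (A `&` e @^-1` [set a]) x -> (A `&` e @^-1` [set a]) x' ->
    phi x = phi x' -> x = x'.
Proof. by move=> [_ se] x x' [_ /= ex] [_ /= ex'] xx'; apply: se; rewrite ?ex. Qed.

Section Stability.
Variables (R : comPzRingType) (W : lmodType R).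
Variables (LG : coefficients W G) (LH : coefficients W H).
Hypothesis sep : separates.

Lemma transfer_push_stable : finite_fibres phi ->
  transfer_stable LG LH (fun x y => phi x = y) -> push_stable LG LH phi.
Proof.
move=> fib st A f Lf; rewrite push_on_split //; apply: Defs.coef_sum => a _.
by apply: st (push_on_carries f (@separation_inj A a sep)) Lf.
Qed.

Lemma transfer_pull_stable :
  transfer_stable LH LG (fun y x => phi x = y) -> pull_stable LG LH phi.
Proof.
move=> st A f Lf; rewrite pull_on_split //; apply: Defs.coef_sum => a _.
by apply: st (pull_on_carries f (@separation_inj A a sep)) Lf => y x [].
Qed.

End Stability.

End Separation.

Lemma separates_id (G : groupType) : separates (id : G -> G) (fun=> 1%g).
Proof. by split=> //; apply: (sub_finite_set _ (finite_set1 1%g)) => _ [x _ <-]. Qed.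

Lemma finite_fibres_id (G : groupType) : finite_fibres (id : G -> G).
Proof. by move=> y; exact: finite_set1. Qed.

Section CoarseMapTheory.
Implicit Types G H K : groupType.

(** All pairs (a x, b x) have the same ratio a b^-1. *)
Lemma coarse_coherent G H (phi : G -> H) : coarse_map phi -> coherent (fun=> phi).
Proof.
move=> [_ cphi] i j a b; set f := fun x => _.
apply: sub_finite_set (cphi [set ((a * x)%g, (b * x)%g) | x in [set: G]] _).
  by move=> _ [x _ <-]; exists ((a * x)%g, (b * x)%g) => //; exists x.
apply: (sub_finite_set _ (finite_set1 (a * b^-1)%g)) => _ [_ [x _ <-] <-] /=.
by rewrite invgM mulgA mulgK.
Qed.

Lemma coarse_comp G H K (phi : G -> H) (psi : H -> K) :
  coarse_map phi -> coarse_map psi -> coarse_map (psi \o phi).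
Proof.
move=> [fphi cphi] [fpsi cpsi]; split=> [z|S fS].
  rewrite (_ : _ @^-1` _ = \bigcup_(y in psi @^-1` [set z]) phi @^-1` [set y]).
    by apply: bigcup_finite => // y _; exact: fphi.
  by apply/seteqP; split=> [x /= xz|x [y /= <- <-]] //; exists (phi x).
apply: sub_finite_set (cpsi [set (phi p.1, phi p.2) | p in S] _).
  by move=> _ [p Sp <-]; exists (phi p.1, phi p.2) => //; exists p.
by apply: sub_finite_set (cphi S fS) => _ [_ [p Sp <-] <-]; exists p.
Qed.

Lemma finite_setMg G (A B : set G) : finite_set A -> finite_set B ->
  finite_set [set (a * b)%g | a in A & b in B].
Proof. exact: finite_image2. Qed.

Lemma finite_setVg G (A : set G) : finite_set A -> finite_set [set a^-1%g | a in A].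
Proof. exact: finite_image. Qed.

(** With f_i the i-th map, the ratio of f_i(a x) and f_j(b x) is split at f_j(a x). The first factor
    compares two maps at one point and is controlled by closeness; the second concerns a single map,
    which is coarse. *)
Lemma coherent_close_id G (k : G -> G) (P : pred nat) : coarse_map k -> close k id ->
  coherent (fun i => if P i then id else k).
Proof.
move=> ck kid.
have cP (b c : bool) :
    finite_set (range (fun x => (if b then id else k) x * ((if c then id else k) x)^-1)%g).
  have f1 : finite_set [set 1%g : G] by exact: finite_set1.
  case: b; case: c => //=.
  - by apply: (sub_finite_set _ f1) => _ [x _ <-]; rewrite mulgV.
  - apply: (sub_finite_set _ (finite_setVg kid)) => _ [x _ <-].
    by exists (k x * x^-1)%g; [exists x | rewrite invgM invgK].
  - by apply: (sub_finite_set _ f1) => _ [x _ <-]; rewrite mulgV.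
have cid (b : bool) : coherent (fun=> if b then id else k : G -> G).
  case: b; last exact: coarse_coherent.
  move=> i j a c; apply: (sub_finite_set _ (finite_set1 (a * c^-1)%g)) => _ [x _ <-] /=.
  by rewrite invgM mulgA mulgK.
move=> i j a b; apply: (sub_finite_set _ (finite_setMg (cP (P i) (P j)) (cid (P j) i j a b))).
move=> _ [x _ <-]; exists ((if P i then id else k) (a * x) *
  ((if P j then id else k) (a * x))^-1)%g; first by exists (a * x)%g.
exists ((if P j then id else k) (a * x) * ((if P j then id else k) (b * x))^-1)%g.
  by exists x.
by rewrite mulgA mulgVK.
Qed.

Lemma coarse_separates G H (phi : G -> H) (psi : H -> G) : close (psi \o phi) id ->
  separates phi (fun x => psi (phi x) * x^-1)%g.
Proof.
move=> cl; split=> // x x' xx'; rewrite xx' => /mulgI /invg_inj //.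
Qed.

End CoarseMapTheory.

(** * Isomorphisms from stability of the coefficients *)

Section Isomorphisms.
Variables (G H : groupType) (phi : G -> H) (psi : H -> G).
Hypothesis (cphi : coarse_map phi) (cpsi : coarse_map psi).
Hypothesis (psiphi : close (psi \o phi) id) (phipsi : close (phi \o psi) id).
Variables (R : comPzRingType) (W : lmodType R).
Variables (LG : coefficients W G) (LH : coefficients W H).

Section Chains.
Hypothesis (sphi : push_stable LG LH phi) (spsi : push_stable LH LG psi).
Hypothesis (sG : push_stable LG LG id) (sH : push_stable LH LH id).

Let push_phi n := push_chains cphi.1 (coarse_coherent cphi) sphi (n := n).
Let push_psi n := push_chains cpsi.1 (coarse_coherent cpsi) spsi (n := n).

(** [BG] and [BH] stand for the boundaries or for their closures, so ordinary and reduced homology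
    are treated together. *)
Lemma push_chains_iso n (BG : submodule (chains LG n)) (BH : submodule (chains LH n)) :
  (forall c, submod_set (boundaries LG n) c -> submod_set BG c) ->
  (forall c, submod_set (boundaries LH n) c -> submod_set BH c) ->
  (forall c, submod_set BG c -> submod_set BH (push_phi c)) ->
  (forall c, submod_set BH c -> submod_set BG (push_psi c)) ->
  induces_iso (cycles LG n) BG (cycles LH n) BH (@pushes G H phi _ _ LG LH n).
Proof.
move=> BBG BBH phiB psiB.
apply: (@induces_isoI _ _ _ _ _ _ _ _ (@push_phi n) (@push_psi n)) => //.
- exact: push_chains_linear.
- exact: push_chains_linear.
- exact: push_cycles.
- exact: push_cycles.
- move=> c zc; apply: BBG.
  have coh P := coherent_close_id P (coarse_comp cphi cpsi) psiphi.
  have [b Bb bE] := chain_homotopy coh (coarse_comp cphi cpsi).1 sG zc.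
  rewrite (_ : _ - _ = b) //; apply: val_inj; rewrite /= bE.
  rewrite -simplex_map_comp pushforward_comp // simplex_map_comp.
  exact: simplex_map_fibre_finite (coarse_comp cphi cpsi).1 _ _ (submodE c).
- move=> c zc; apply: BBH.
  have coh P := coherent_close_id P (coarse_comp cpsi cphi) phipsi.
  have [b Bb bE] := chain_homotopy coh (coarse_comp cpsi cphi).1 sH zc.
  rewrite (_ : _ - _ = b) //; apply: val_inj; rewrite /= bE.
  rewrite -simplex_map_comp pushforward_comp // simplex_map_comp.
  exact: simplex_map_fibre_finite (coarse_comp cpsi cphi).1 _ _ (submodE c).
Qed.

Lemma homology_isoI : homology_iso phi LG LH.
Proof.
by move=> n; apply: push_chains_iso => // c; exact: push_boundaries.
Qed.

End Chains.

Section Cochains.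
Hypothesis (sphi : pull_stable LG LH phi) (spsi : pull_stable LH LG psi).
Hypothesis (sG : pull_stable LG LG id) (sH : pull_stable LH LH id).

Let pull_phi n := pull_cochains (coarse_coherent cphi) sphi (n := n).
Let pull_psi n := pull_cochains (coarse_coherent cpsi) spsi (n := n).

Lemma pull_cochains_iso n (BG : submodule (cochains LG n)) (BH : submodule (cochains LH n)) :
  (forall c, submod_set (coboundaries LG n) c -> submod_set BG c) ->
  (forall c, submod_set (coboundaries LH n) c -> submod_set BH c) ->
  (forall c, submod_set BH c -> submod_set BG (pull_phi c)) ->
  (forall c, submod_set BG c -> submod_set BH (pull_psi c)) ->
  induces_iso (cocycles LH n) BH (cocycles LG n) BG (@pulls G H phi _ _ LG LH n).
Proof.
move=> BBG BBH phiB psiB.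
apply: (@induces_isoI _ _ _ _ _ _ _ _ (@pull_phi n) (@pull_psi n)) => //.
- exact: pull_cochains_linear.
- exact: pull_cochains_linear.
- exact: pull_cocycles.
- exact: pull_cocycles.
- move=> c zc; apply: BBH.
  have coh P := coherent_close_id P (coarse_comp cpsi cphi) phipsi.
  have [b Bb bE] := cochain_homotopy coh sH zc.
  rewrite (_ : _ - _ = b) //; apply: val_inj; rewrite /= bE.
  by rewrite -simplex_map_comp.
- move=> c zc; apply: BBG.
  have coh P := coherent_close_id P (coarse_comp cphi cpsi) psiphi.
  have [b Bb bE] := cochain_homotopy coh sG zc.
  rewrite (_ : _ - _ = b) //; apply: val_inj; rewrite /= bE.
  by rewrite -simplex_map_comp.
Qed.

Lemma cohomology_isoI : cohomology_iso phi LG LH.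
Proof.
by move=> n; apply: pull_cochains_iso => // c; exact: pull_coboundaries.
Qed.

End Cochains.

End Isomorphisms.

(** * Continuity of the induced maps *)

Lemma closure_image (S T : topologicalType) (f : S -> T) (B : set S) (B' : set T) x :
  f @ x --> f x -> (forall y, B y -> B' (f y)) -> closure B x -> closure B' (f x).
Proof.
move=> fx fB Bx U /fx /= /Bx [y [By Uy]]; exists (f y); split=> //.
exact: fB.
Qed.

Lemma submod_val_sum (R : pzRingType) (V : lmodType R) (S : submodule V) (I : Type)
    (r : seq I) (f : I -> submod_type S) :
  submod_val (\sum_(i <- r) f i) = \sum_(i <- r) submod_val (f i).
Proof. exact: (raddf_sum val). Qed.

Definition transfer_bounded (R : realType) (F : scalars R) (G H : groupType)
    (LG : topological_coefficients F G) (LH : topological_coefficients F H)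
    (rel : G -> H -> Prop) :=
  forall j : quasinorm_index LH, exists i : quasinorm_index LG, exists2 C : R, 0 <= C &
    forall rho (u : G -> F) (v : H -> F), (forall x y, rho x y -> rel x y) ->
      carries rho u v -> (quasinorm j v <= C%:E * quasinorm i u)%E.

Section CoefSpaceTopology.
Variables (R : realType) (F : scalars R).

Lemma coef_sum_cvg (G : groupType) (L : topological_coefficients F G) (T I : Type)
    (Q : set_system T) (r : seq I) (f : I -> T -> coef_space L) (l : I -> coef_space L) :
  Filter Q -> (forall i, f i x @[x --> Q] --> l i) ->
  (\sum_(i <- r) f i x) @[x --> Q] --> (\sum_(i <- r) l i : coef_space L).
Proof.
move=> FQ fl; elim: r => [|i r IH].
  rewrite big_nil; under eq_fun do rewrite big_nil; exact: cvg_cst.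
rewrite big_cons -[l i]scale1r; under eq_fun do rewrite big_cons -[f i _]scale1r.
move=> A /coef_spaceP [[P P'] /= [lP rP] PA].
have h1 : Q [set x | P (f i x)] := fl i _ lP.
have h2 : Q [set x | P' (\sum_(j <- r) f j x)] := IH _ rP.
suff : Q [set x | A (1 *: f i x + \sum_(j <- r) f j x)] by [].
by apply: filterS (filterI h1 h2) => x Px; exact: (PA (_, _)).
Qed.

Variables (G H : groupType).
Variables (LG : topological_coefficients F G) (LH : topological_coefficients F H).

(** An entourage involves finitely many quasi-norms, so a finite intersection of the neighbourhoods
    [V j] suffices. The bound is on differences, which for additive [T] is the usual bound. *)
Lemma bounded_continuous (T : coef_space LG -> coef_space LH) :
  (forall j : quasinorm_index LH, exists i : quasinorm_index LG,
    exists2 C : R, 0 <= C & forall f g,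
    (quasinorm j (submod_val (T f) - submod_val (T g))%R <=
     C%:E * quasinorm i (submod_val f - submod_val g)%R)%E) ->
  continuous T.
Proof.
move=> bT f U /nbhsP [E [A fA [e e0 AE]] EU].
pose V (j : {classic quasinorm_index LH}) := [set g : coef_space LG |
  (quasinorm j (submod_val (T f) - submod_val (T g))%R < e%:E)%E].
have nV j : nbhs f (V j).
  have [i [C C0 bij]] := bT j.
  (* The radius e / (1 + C) is defined also for C = 0 and gives C e / (1 + C) < e. *)
  have C1 : 0 < 1 + C by rewrite ltr_pwDl.
  apply/nbhsP; exists [set fg : coef_space LG * coef_space LG |
    (quasinorm i (submod_val fg.1 - submod_val fg.2)%R < (e / (1 + C))%:E)%E].
    exists [set i]; first exact: finite_set1.
    by exists (e / (1 + C)); [rewrite divr_gt0 | move=> ? ? /(_ i erefl)].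
  move=> g; rewrite /xsection /= inE /V /= => fg.
  apply: le_lt_trans (bij f g) _.
  apply: (@le_lt_trans _ _ (C%:E * (e / (1 + C))%:E)%E).
    by apply: lee_wpmul2l; [rewrite lee_fin | exact: ltW].
  by rewrite -EFinM lte_fin mulrA ltr_pdivrMr // mulrC ltr_pM2l // ltrDr.
have fA' : finite_set (A : set {classic quasinorm_index LH}) by [].
suff : nbhs f [set g | U (T g)] by [].
have h := @filter_bigI _ _ (fset_set (A : set {classic quasinorm_index LH})) V _
  (nbhs_filter f) (fun j _ => nV j).
apply: filterS h => g Vg.
apply: EU; rewrite /xsection /= inE; apply: AE => j Aj; apply: Vg => /=.
by rewrite in_fset_set //; apply/mem_set.
Qed.

Lemma push_onB (phi : G -> H) A (f g : G -> F^o) : finite_fibres phi ->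
  push_on phi A (f - g) = push_on phi A f - push_on phi A g.
Proof.
move=> fib; have ff (u : G -> F^o) : fibre_finite phi u.
  by move=> y; apply: sub_finite_set (fib y) => x [].
rewrite /push_on addrC -scaleN1r addrC -[RHS]addrC -[- _ in RHS]scaleN1r.
rewrite -pushforwardP //; congr pushforward; apply/funext => x; rewrite addrC.
rewrite -[RHS]/(-1 *: patch (fun=> 0) A g x + patch (fun=> 0) A f x) /patch.
case: ifP => // _; by rewrite scaler0 addr0.
Qed.

Lemma pull_onB (phi : G -> H) A (f g : H -> F^o) :
  pull_on phi A (f - g) = pull_on phi A f - pull_on phi A g.
Proof.
apply/funext => x.
rewrite -[RHS]/(pull_on phi A f x - pull_on phi A g x) /pull_on /patch.
by case: ifP => // _; rewrite subr0.
Qed.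

End CoefSpaceTopology.

Section Operators.
Variables (R : realType) (F : scalars R) (G H : groupType).
Variables (LG : topological_coefficients F G) (LH : topological_coefficients F H).
Variables (phi : G -> H) (e : G -> G).
Hypothesis sep : separates phi e.

Section Push.
Hypotheses (fib : finite_fibres phi) (stab : push_stable LG LH phi).
Hypothesis bnd : transfer_bounded LG LH (fun x y => phi x = y).

Definition push_coef A (f : coef_space LG) : coef_space LH :=
  mk_submod (stab A (submodE f)).

(** On each level set of [e] the operator is a transfer along [phi]. By additivity a difference of
    images is the transfer of the difference, so the norm bound applies. *)
Lemma push_coef_continuous A : continuous (push_coef A).
Proof.
have -> : push_coef A = fun f => \sum_(a <- separation_pieces e)
    push_coef (A `&` e @^-1` [set a]) f.
  apply/funext => f; apply: val_inj.
  by rewrite /= submod_val_sum (push_on_split _ _ sep fib).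
move=> f; apply: (@coef_sum_cvg _ _ _ _ _ _ _ _
  (fun a => push_coef (A `&` e @^-1` [set a])) _ (nbhs_filter f)) => a.
apply: bounded_continuous => j {f}.
have [i [C C0 Cij]] := bnd j; exists i, C => // f g.
by rewrite /= -push_onB //; apply: Cij (push_on_carries _ (separation_inj sep)).
Qed.

End Push.

Section Pull.
Hypothesis stab : pull_stable LG LH phi.
Hypothesis bnd : transfer_bounded LH LG (fun y x => phi x = y).

Definition pull_coef A (f : coef_space LH) : coef_space LG :=
  mk_submod (stab A (submodE f)).

Lemma pull_coef_continuous A : continuous (pull_coef A).
Proof.
have -> : pull_coef A = fun f => \sum_(a <- separation_pieces e)
    pull_coef (A `&` e @^-1` [set a]) f.
  apply/funext => f; apply: val_inj.
  by rewrite /= submod_val_sum (pull_on_split _ _ sep).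
move=> f; apply: (@coef_sum_cvg _ _ _ _ _ _ _ _
  (fun a => pull_coef (A `&` e @^-1` [set a])) _ (nbhs_filter f)) => a.
apply: bounded_continuous => j {f}.
have [i [C C0 Cij]] := bnd j; exists i, C => // f g; rewrite /= -pull_onB.
by apply: Cij (pull_on_carries _ (separation_inj sep)) => y x [].
Qed.

End Pull.
End Operators.

Section CoarseEquivalenceTheory.
Variables (G H : groupType) (phi : G -> H) (psi : H -> G).
Hypothesis (cpsi : coarse_map psi) (psiphi : close (psi \o phi) id).

(** s t^-1 is the product of (psi(phi s) s^-1)^-1, psi(phi s) psi(phi t)^-1 and psi(phi t) t^-1.
    Closeness bounds the outer factors and coarseness of [psi] the middle one. *)
Lemma coarse_expanding (a : H) : finite_set
  [set (p.1 * p.2^-1)%g | p in [set p : G * G | phi p.1 * (phi p.2)^-1 = a]%g].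
Proof.
set S := [set p | _].
have fS : finite_set [set (p.1 * p.2^-1)%g | p in [set (phi p.1, phi p.2) | p in S]].
  by apply: (sub_finite_set _ (finite_set1 a)) => _ [_ [p Sp <-] <-].
apply: sub_finite_set (finite_setMg (finite_setVg psiphi)
  (finite_setMg (cpsi.2 _ fS) psiphi)) => _ [p Sp <-].
exists (psi (phi p.1) * p.1^-1)^-1%g.
  by exists (psi (phi p.1) * p.1^-1)%g => //; exists p.1.
exists (psi (phi p.1) * (psi (phi p.2))^-1 * (psi (phi p.2) * p.2^-1))%g.
  exists (psi (phi p.1) * (psi (phi p.2))^-1)%g.
    by exists (phi p.1, phi p.2) => //; exists p.
  by exists (psi (phi p.2) * p.2^-1)%g => //; exists p.2.
by rewrite invgM invgK !mulgA mulgVK mulgVK.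
Qed.

(** Each entry of g is a ratio of vertices whose images have the corresponding entry of h as
    ratio. *)
Lemma simplex_map_expanding n (h : n.-tuple H) :
  finite_set [set g : n.-tuple G | exists x, (simplex_map phi (x, g)).2 = h].
Proof.
set D := [set g | _].
have fD : finite_set (range (fun g : {g | D g} => [tuple tnth (sval g) i | i < n])).
  apply: finite_range_tuple => i.
  apply: sub_finite_set (coarse_expanding (tnth h i)) => _ [[g [x gh]] _ <-] /=.
  exists (vertex x g i, vertex x g i.+1); last exact: vertex_ratio.
  by rewrite -gh /= tnth_mktuple.
apply: sub_finite_set fD => g Dg; exists (exist _ g Dg) => //.
by apply: eq_from_tnth => i; rewrite tnth_mktuple.
Qed.

End CoarseEquivalenceTheory.

Section InducedContinuity.
Variables (R : realType) (F : scalars R) (G H : groupType) (phi : G -> H) (e : G -> G).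
Variables (LG : topological_coefficients F G) (LH : topological_coefficients F H).
Hypotheses (coh : coherent (fun=> phi)) (sep : separates phi e).

(** The list [r] depends on h and not on the chain. The slice at h is thus a fixed finite sum of
    continuous operators applied to slices of the argument. *)
Lemma push_chains_continuous (fib : finite_fibres phi) (stab : push_stable LG LH phi) :
  transfer_bounded LG LH (fun x y => phi x = y) ->
  (forall n (h : n.-tuple H),
    finite_set [set g : n.-tuple G | exists x, (simplex_map phi (x, g)).2 = h]) ->
  forall n, continuous (push_chains fib coh stab (n := n) : chain_space LG n -> chain_space LH n).
Proof.
move=> bnd exph n c; apply/(chain_space_cvgE _ (fmap_filter _ (nbhs_filter c))) => h.
pose r := finmap.enum_fset (fset_set
  [set g : n.-tuple G | exists x, (simplex_map phi (x, g)).2 = h]).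
pose A (g : n.-tuple G) := [set x | (simplex_map phi (x, g)).2 = h].
have sliceE b : chain_slice (push_chains fib coh stab b) h =
    \sum_(g <- r) push_coef stab (A g) (chain_slice b g).
  apply: val_inj; rewrite /= submod_val_sum simplex_mapE.
  rewrite (@slice_pushforward _ _ _ _ _ _ fib _ _ _ _ _ r) ?finmap.fset_uniq //.
  move=> x g _; rewrite -simplex_mapE => gh.
  by rewrite /r in_fset_set; [apply/mem_set; exists x | exact: exph].
rewrite sliceE.
suff : (fun b => chain_slice (push_chains fib coh stab b) h) @ nbhs (c : chain_space LG n)
  --> \sum_(g <- r) push_coef stab (A g) (chain_slice c g) by [].
rewrite (funext sliceE).
apply: (@coef_sum_cvg _ _ _ LH _ _ _ r
  (fun g b => push_coef stab (A g) (chain_slice b g)) _ (nbhs_filter (c : chain_space LG n))).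
move=> g; apply: (continuous_cvg _
  (@push_coef_continuous _ _ _ _ _ _ _ _ sep fib stab bnd (A g) _)).
by move: g; apply/(chain_space_cvgE _ (nbhs_filter c)); exact: cvg_id.
Qed.

(** Here the fixed finite list consists of the image tuples over g, and its finiteness is
    coherence. *)
Lemma pull_cochains_continuous (stab : pull_stable LG LH phi) :
  transfer_bounded LH LG (fun y x => phi x = y) ->
  forall n, continuous (pull_cochains coh stab (n := n) : cochain_space LH n -> cochain_space LG n).
Proof.
move=> bnd n c; apply/(cochain_space_cvgE _ (fmap_filter _ (nbhs_filter c))) => g.
have fg := @vertex_map_tuple_finite _ _ _ id n n g coh.
pose r := finmap.enum_fset (fset_set
  (range (fun x => (vertex_map (fun=> phi) id n (x, g)).2))).
pose A (h : n.-tuple H) := [set x | (vertex_map (fun=> phi) id n (x, g)).2 = h].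
have sliceE b : cochain_slice (pull_cochains coh stab b) g =
    \sum_(h <- r) pull_coef stab (A h) (cochain_slice b h).
  apply: val_inj; rewrite /= submod_val_sum simplex_mapE.
  rewrite (@slice_pullback _ _ _ _ (fun=> phi) id _ _ _ _ _ r) ?finmap.fset_uniq //.
  by move=> x; rewrite in_fset_set //; apply/mem_set; exists x.
rewrite sliceE.
suff : (fun b => cochain_slice (pull_cochains coh stab b) g) @ nbhs (c : cochain_space LH n)
  --> \sum_(h <- r) pull_coef stab (A h) (cochain_slice c h) by [].
rewrite (funext sliceE).
apply: (@coef_sum_cvg _ _ _ LG _ _ _ r
  (fun h b => pull_coef stab (A h) (cochain_slice b h)) _ (nbhs_filter (c : cochain_space LH n))).
move=> h; apply: (continuous_cvg _
  (@pull_coef_continuous _ _ _ _ _ _ _ _ sep stab bnd (A h) _)).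
by move: h; apply/(cochain_space_cvgE _ (nbhs_filter c)); exact: cvg_id.
Qed.

End InducedContinuity.

(** * Isomorphisms from stability and boundedness under transfers *)

Section TransferIsomorphisms.
Variables (G H : groupType) (phi : G -> H) (psi : H -> G).
Hypothesis (cphi : coarse_map phi) (cpsi : coarse_map psi).
Hypothesis (psiphi : close (psi \o phi) id) (phipsi : close (phi \o psi) id).

Let sepphi := coarse_separates psiphi.
Let seppsi := coarse_separates phipsi.

Section Algebraic.
Variables (R : comPzRingType) (W : lmodType R).
Variables (LG : coefficients W G) (LH : coefficients W H).

Lemma transfer_homology_iso :
  transfer_stable LG LH (fun x y => phi x = y) ->
  transfer_stable LH LG (fun y x => psi y = x) ->
  transfer_stable LG LG eq -> transfer_stable LH LH eq -> homology_iso phi LG LH.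
Proof.
move=> tphi tpsi tG tH; apply: (homology_isoI cphi cpsi) => //.
- exact: (transfer_push_stable sepphi cphi.1).
- exact: (transfer_push_stable seppsi cpsi.1).
- exact: (transfer_push_stable (@separates_id G) (@finite_fibres_id G)).
- exact: (transfer_push_stable (@separates_id H) (@finite_fibres_id H)).
Qed.

Lemma transfer_cohomology_iso :
  transfer_stable LH LG (fun y x => phi x = y) ->
  transfer_stable LG LH (fun x y => psi y = x) ->
  transfer_stable LG LG eq -> transfer_stable LH LH eq -> cohomology_iso phi LG LH.
Proof.
move=> tphi tpsi tG tH; apply: (cohomology_isoI cphi cpsi) => //.
- exact: (transfer_pull_stable sepphi).
- exact: (transfer_pull_stable seppsi).
- apply: (transfer_pull_stable (@separates_id G)) => rho u v sub.
  by apply: tG => x y /sub ->.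
- apply: (transfer_pull_stable (@separates_id H)) => rho u v sub.
  by apply: tH => x y /sub ->.
Qed.

End Algebraic.

Section Reduced.
Variables (R : realType) (F : scalars R).
Variables (LG : topological_coefficients F G) (LH : topological_coefficients F H).

Lemma transfer_reduced_homology_iso :
  transfer_stable LG LH (fun x y => phi x = y) ->
  transfer_stable LH LG (fun y x => psi y = x) ->
  transfer_stable LG LG eq -> transfer_stable LH LH eq ->
  transfer_bounded LG LH (fun x y => phi x = y) ->
  transfer_bounded LH LG (fun y x => psi y = x) ->
  reduced_homology_iso phi LG LH.
Proof.
move=> tphi tpsi tG tH bphi bpsi n.
pose sphi := transfer_push_stable sepphi cphi.1 tphi.
pose spsi := transfer_push_stable seppsi cpsi.1 tpsi.
have sG := transfer_push_stable (@separates_id G) (@finite_fibres_id G) tG.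
have sH := transfer_push_stable (@separates_id H) (@finite_fibres_id H) tH.
apply: (@push_chains_iso _ _ _ _ cphi cpsi psiphi phipsi _ _ LG LH sphi spsi sG sH n
  (closed_boundaries LG n) (closed_boundaries LH n)).
- by move=> c; exact: (@subset_closure (chain_space LG n)).
- by move=> c; exact: (@subset_closure (chain_space LH n)).
- move=> c; apply: (@closure_image (chain_space LG n) (chain_space LH n)).
    exact: (@push_chains_continuous _ _ _ _ _ _ _ _ (coarse_coherent cphi) sepphi
      cphi.1 sphi bphi (@simplex_map_expanding _ _ _ _ cpsi psiphi) n).
  exact: push_boundaries.
- move=> c; apply: (@closure_image (chain_space LH n) (chain_space LG n)).
    exact: (@push_chains_continuous _ _ _ _ _ _ _ _ (coarse_coherent cpsi) seppsi
      cpsi.1 spsi bpsi (@simplex_map_expanding _ _ _ _ cphi phipsi) n).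
  exact: push_boundaries.
Qed.

Lemma transfer_reduced_cohomology_iso :
  transfer_stable LH LG (fun y x => phi x = y) ->
  transfer_stable LG LH (fun x y => psi y = x) ->
  transfer_stable LG LG eq -> transfer_stable LH LH eq ->
  transfer_bounded LH LG (fun y x => phi x = y) ->
  transfer_bounded LG LH (fun x y => psi y = x) ->
  reduced_cohomology_iso phi LG LH.
Proof.
move=> tphi tpsi tG tH bphi bpsi n.
pose sphi := transfer_pull_stable sepphi tphi.
pose spsi := transfer_pull_stable seppsi tpsi.
have sG : pull_stable LG LG id.
  apply: (transfer_pull_stable (@separates_id G)) => rho u v sub.
  by apply: tG => x y /sub ->.
have sH : pull_stable LH LH id.
  apply: (transfer_pull_stable (@separates_id H)) => rho u v sub.
  by apply: tH => x y /sub ->.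
apply: (@pull_cochains_iso _ _ _ _ cphi cpsi psiphi phipsi _ _ LG LH sphi spsi sG sH n
  (closed_coboundaries LG n) (closed_coboundaries LH n)).
- by move=> c; exact: (@subset_closure (cochain_space LG n)).
- by move=> c; exact: (@subset_closure (cochain_space LH n)).
- move=> c; apply: (@closure_image (cochain_space LH n) (cochain_space LG n)).
    exact: (@pull_cochains_continuous _ _ _ _ _ _ _ _ (coarse_coherent cphi) sepphi
      sphi bphi n).
  exact: pull_coboundaries.
- move=> c; apply: (@closure_image (cochain_space LG n) (cochain_space LH n)).
    exact: (@pull_cochains_continuous _ _ _ _ _ _ _ _ (coarse_coherent cpsi) seppsi
      spsi bpsi n).
  exact: pull_coboundaries.
Qed.

End Reduced.

End TransferIsomorphisms.

(** * Transfers in the coefficient modules *)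

Section AlgebraicTransfers.
Variables (R : comPzRingType) (W : lmodType R) (G H : groupType) (rel : G -> H -> Prop).

Lemma all_functions_transfer :
  transfer_stable (all_functions W G) (all_functions W H) rel.
Proof. by []. Qed.

Lemma finite_valued_transfer :
  transfer_stable (finite_valued W G) (finite_valued W H) rel.
Proof.
move=> rho u v _ [_ uv] fu.
apply: (@sub_finite_set _ _ ([set 0] `|` range u)).
  by move=> _ [y _ <-]; have [->|[x _ ->]] := uv y; [left | right; exists x].
by rewrite finite_setU; split; first exact: finite_set1.
Qed.

End AlgebraicTransfers.

Lemma partial_function_graph (X Y : Type) (rho : X -> Y -> Prop) (y0 : Y) :
  partial_function rho -> exists t : X -> Y, forall x y, rho x y -> t x = y.
Proof.
move=> prho; have /choice[t tP] : forall x, exists y, forall y', rho x y' -> y = y'.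
  move=> x; have [[y xy]|nxy] := pselect (exists y, rho x y).
    by exists y => y' xy'; exact: prho xy'.
  by exists y0 => y' xy'; case: nxy; exists y'.
by exists t.
Qed.

(** Excluding [P 0] forces a point y with [P (v y)] to have a source x with [P (u x)], and the
    partial function sends x to y. *)
Lemma carries_finite (G H : groupType) (V : nmodType) rho (u : G -> V) (v : H -> V)
    (P : V -> Prop) :
  carries rho u v -> ~ P 0 -> finite_set [set x | P (u x)] ->
  finite_set [set y | P (v y)].
Proof.
move=> [prho uv] P0 fu; have [t tP] := partial_function_graph 1%g prho.
apply: sub_finite_set (finite_image t fu) => y /= Pvy.
by have [v0|[x xy vu]] := uv y; [case: P0; rewrite -v0 | exists x; rewrite /= -?vu //; exact: tP].
Qed.

Lemma finitely_supported_transfer (R : comPzRingType) (W : lmodType R)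
    (G H : groupType) (rel : G -> H -> Prop) :
  transfer_stable (finitely_supported W G) (finitely_supported W H) rel.
Proof.
by move=> rho u v _ uv; apply: (carries_finite (P := fun w => w <> 0) uv); apply.
Qed.

Section NormTransfers.
Variables (R : realType) (F : scalars R) (G H : groupType).

(** A choice of sources [s] is injective on the support of v because [rho] is functional, so the sum
    of |u(s y)|^p is part of the sum for u. The factor [c] absorbs ratios of weights. *)
Lemma lpnorm_transfer p (c : R) rho (u : G -> F) (v : H -> F) :
  (0 < p)%E -> 0 <= c -> partial_function rho ->
  (forall y, absv (v y) = 0 \/ exists2 x, rho x y & absv (v y) <= c * absv (u x)) ->
  (lpnorm p v <= c%:E * lpnorm p u)%E.
Proof.
move=> p0 c0 prho uv.
have /choice[s sP] : forall y, exists x, absv (v y) <> 0 ->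
    rho x y /\ absv (v y) <= c * absv (u x).
  by move=> y; have [v0|[x xy vu]] := uv y; [exists 1%g | exists x].
pose Y := [set y | absv (v y) <> 0].
pose w y : F := if y \in Y then u (s y) else 0.
have vw y : absv (v y) <= c * absv (w y).
  rewrite /w; case: ifPn => [/set_mem /sP[] //|]; rewrite notin_setE => /contrapT ->.
  by rewrite absv0 mulr0.
apply: le_trans (lpnorm_le p0 c0 vw) _; apply: lee_wpmul2l; first by rewrite lee_fin.
case: p p0 => [r| |] // p0; last first.
  apply: ge_ereal_sup => _ [y _ <-]; rewrite /w; case: ifP => _.
    by apply: ereal_sup_ubound; exists (s y).
  by rewrite absv0; exact: (lpnorm_ge0 +oo u).
rewrite lte_fin in p0; have ip0 : 0 <= r^-1 by rewrite invr_ge0 ltW.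
have injs : set_bij Y (s @` Y) s.
  split=> [y Yy|y y' /set_mem Yy /set_mem Yy' e|x [y Yy <-]]; [by exists y | | by exists y].
  by apply: prho (sP _ Yy).1 _; rewrite e; exact: (sP _ Yy').1.
apply: (gt0_ler_poweR ip0); rewrite ?in_itv /= ?leey ?andbT //.
- by apply: esum_ge0 => x _; rewrite lee_fin powR_ge0.
- by apply: esum_ge0 => x _; rewrite lee_fin powR_ge0.
apply: (@le_trans _ _ (\esum_(x in s @` Y) (absv (u x) `^ r)%:E)%E).
  rewrite (reindex_esum _ _ _ _ injs) [leRHS]esum_mkcond; apply: le_esum => y _.
  by rewrite /w; case: ifP => // _; rewrite absv0 powR0 ?gt_eqF.
rewrite esum_mkcond; apply: le_esum => x _.
by case: ifP => // _; rewrite lee_fin powR_ge0.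
Qed.

Lemma lpnorm_carries p rho (u : G -> F) (v : H -> F) : (0 < p)%E ->
  carries rho u v -> (lpnorm p v <= 1%:E * lpnorm p u)%E.
Proof.
move=> p0 [prho uv]; apply: (lpnorm_transfer p0 ler01 prho) => y.
have [->|[x xy ->]] := uv y; [by left; rewrite absv0 | right].
by exists x; rewrite ?mul1r.
Qed.

Lemma lp_transfer p (p0 : (0 < p)%E) (rel : G -> H -> Prop) :
  transfer_stable (lp_space F G p0) (lp_space F H p0) rel.
Proof.
move=> rho u v _ uv up; apply: le_lt_trans (lpnorm_carries p0 uv) _.
by rewrite mul1e.
Qed.

Lemma lp_transfer_bounded p (p0 : (0 < p)%E) (rel : G -> H -> Prop) :
  transfer_bounded (lp_space F G p0) (lp_space F H p0) rel.
Proof. by move=> j; exists tt, 1 => // rho u v _; exact: lpnorm_carries. Qed.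

Lemma c0_transfer (rel : G -> H -> Prop) :
  transfer_stable (c0_space F G) (c0_space F H) rel.
Proof.
move=> rho u v _ uv u0 e e0.
apply: (carries_finite (P := fun a : F => is_true (e <= absv a)) uv) (u0 e e0).
by rewrite absv0 leNgt e0.
Qed.

Lemma c0_transfer_bounded (rel : G -> H -> Prop) :
  transfer_bounded (c0_space F G) (c0_space F H) rel.
Proof. by move=> j; exists tt, 1 => // rho u v _; exact: lpnorm_carries. Qed.

Variables (S : generating_set G) (T : generating_set H) (rel : G -> H -> Prop).

(** Adding one to the lengths, as in the Sobolev weights, lets a single factor K absorb additive
    errors too. *)
Definition length_comparable := exists K : nat, forall x y, rel x y ->
  ((word_length T y).+1 <= K * (word_length S x).+1)%N /\
  ((word_length S x).+1 <= K * (word_length T y).+1)%N.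

Hypothesis cmp : length_comparable.

(** For r >= 0 the upper bound on the length of y is used; for r < 0 powers reverse the order and
    the bound on the length of x is used. The constant is K to the power |r|. *)
Lemma weight_comparable (r : R) : exists2 c : R, 0 <= c &
  forall x y, rel x y -> weight T r y <= c * weight S r x.
Proof.
have [K KP] := cmp.
have l0 n : 0 <= 1 + n%:R :> R by rewrite addr_ge0.
have lp n : 0 < 1 + n%:R :> R by rewrite ltr_wpDr.
have K0 : 0 <= K%:R :> R by [].
have [r0|r0] := leP 0 r.
  exists (K%:R `^ r) => [|x y /KP[xy _]]; first exact: powR_ge0.
  rewrite /weight -powRM //; apply: ge0_ler_powR; rewrite ?nnegrE ?mulr_ge0 //.
  by rewrite !nat1r -natrM ler_nat.
exists (K%:R `^ (- r)) => [|x y /KP[_ xy]]; first exact: powR_ge0.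
rewrite /weight -[r in leLHS]opprK -[r in X in _ <= _ * X]opprK.
rewrite !(powRN _ (- r)) ler_pdivlMr ?powR_gt0 //.
rewrite mulrC ler_pdivrMr ?powR_gt0 // -powRM //.
apply: ge0_ler_powR; rewrite ?nnegrE ?mulr_ge0 ?oppr_ge0 ?(ltW r0) //.
by rewrite !nat1r -natrM ler_nat.
Qed.

Lemma sobolev_norm_carries p (r : R) : (0 < p)%E -> exists2 c : R, 0 <= c &
  forall rho (u : G -> F) (v : H -> F), (forall x y, rho x y -> rel x y) ->
    carries rho u v -> (sobolev_norm T p r v <= c%:E * sobolev_norm S p r u)%E.
Proof.
move=> p0; have [c c0 cw] := weight_comparable r; exists c => // rho u v sub [prho uv].
apply: (lpnorm_transfer p0 c0 prho) => y; rewrite absv_weighted.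
have [->|[x xy ->]] := uv y; first by left; rewrite absv0 mul0r.
right; exists x => //; rewrite absv_weighted mulrCA.
by apply: ler_wpM2l; [exact: absv_ge0 | apply: cw; exact: sub].
Qed.

Lemma sobolev_transfer s p (p0 : (0 < p)%E) :
  transfer_stable (sobolev_space F S s p0) (sobolev_space F T s p0) rel.
Proof.
move=> rho u v sub uv us r sr; have [c c0 cP] := sobolev_norm_carries r p0.
apply: le_lt_trans (cP _ _ _ sub uv) _.
by rewrite lte_mul_pinfty ?lee_fin //; exact: us.
Qed.

Lemma sobolev_transfer_bounded s p (p0 : (0 < p)%E) :
  transfer_bounded (sobolev_space F S s p0) (sobolev_space F T s p0) rel.
Proof. by move=> r; exists r; exact: sobolev_norm_carries. Qed.

End NormTransfers.

(** * Distortion of word lengths by coarse maps *)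

Section CoarseLength.

Lemma length_comparable_sym (G H : groupType) (S : generating_set G)
    (T : generating_set H) (rel : G -> H -> Prop) :
  length_comparable S T rel -> length_comparable T S (fun y x => rel x y).
Proof. by move=> [K KP]; exists K => y x /KP[]. Qed.

Lemma length_comparable_eq (G : groupType) (S : generating_set G) :
  length_comparable S S eq.
Proof. by exists 1%N => x _ <-; rewrite mul1n. Qed.

Lemma word_length_bounded (G : groupType) (S : generating_set G) (A : set G) :
  finite_set A -> exists M, forall x, A x -> (word_length S x <= M)%N.
Proof.
move=> fA; exists (\max_(x <- finmap.enum_fset (fset_set A)) word_length S x)%N => x Ax.
apply: (@leq_bigmax_seq _ _ xpredT) => //.
by rewrite in_fset_set //; apply/mem_set.
Qed.

(** Pairs that differ by a generator on the left have images with finitely many ratios, of length at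
    most M. Walking along a shortest word for x bounds the length of phi(x) phi(1)^-1 by M times
    that of x. *)
Lemma coarse_length (G H : groupType) (phi : G -> H) (S : generating_set G)
    (T : generating_set H) : coarse_map phi ->
  exists K, forall x, ((word_length T (phi x)).+1 <= K * (word_length S x).+1)%N.
Proof.
move=> [_ cphi]; pose E := [set p : G * G | generators S (p.1 * p.2^-1)%g].
have /(word_length_bounded T) [M MP] :
    finite_set [set (phi p.1 * (phi p.2)^-1)%g | p in E].
  apply: cphi; apply: (sub_finite_set _ (generators_finite S)).
  by move=> _ [p Ep <-].
have step (w : seq G) : (forall s, s \in w -> generators S s) ->
    (word_length T (phi (\prod_(s <- w) s) * (phi 1)^-1)%g <= size w * M)%N.
  elim: w => [_|s w IH Sw].
    rewrite big_nil mulgV mul0n; apply: word_length_le; exists [::].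
    by split=> //; rewrite big_nil.
  have Sw' t : t \in w -> generators S t by move=> tw; apply: Sw; rewrite in_cons tw orbT.
  rewrite big_cons; set y := (\prod_(t <- w) t)%g.
  rewrite (_ : phi (s * y) * (phi 1)^-1 =
    (phi (s * y) * (phi y)^-1) * (phi y * (phi 1)^-1))%g; last by rewrite mulgA mulgVK.
  apply: leq_trans (word_lengthM T _ _) _; rewrite /= mulSn; apply: leq_add; last exact: IH.
  apply: MP; exists ((s * y)%g, y) => //=; rewrite /E /= mulgK.
  by apply: Sw; rewrite mem_head.
(* The terms of K account for the steps of the walk, for phi(1) and for the added one. *)
exists (M + word_length T (phi 1%g))%N.+1 => x.
have [w [sw Sw xE]] := word_lengthP S x.
have := step w Sw; rewrite -xE sw => h.
have := word_lengthM T (phi x * (phi 1)^-1)%g (phi 1%g); rewrite mulgVK => h'.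
move: h h'; set a := word_length T (phi x); set b := word_length T _.
set c := word_length T _; set n := word_length S x.
nia.
Qed.

Lemma coarse_length_comparable (G H : groupType) (phi : G -> H) (psi : H -> G)
    (S : generating_set G) (T : generating_set H) :
  coarse_map phi -> coarse_map psi -> close (psi \o phi) id ->
  length_comparable S T (fun x y => phi x = y).
Proof.
move=> cphi cpsi cl.
have [K KP] := coarse_length S T cphi; have [K' KP'] := coarse_length T S cpsi.
have [M MP] := word_length_bounded S (finite_setVg cl).
(* K serves the first bound. The second uses x = (psi(phi x) x^-1)^-1 psi(phi x), where M bounds the
   first factor and K' the growth under [psi]. *)
exists (K + M + K')%N => x _ <-; split; first by have := KP x; nia.
have := KP' (phi x); have := word_lengthM S (psi (phi x) * x^-1)^-1%g (psi (phi x)).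
rewrite invgM invgK mulgVK.
have : (word_length S (x * (psi (phi x))^-1)%g <= M)%N.
  apply: MP; exists (psi (phi x) * x^-1)%g; first by exists x.
  by rewrite invgM invgK.
move: (word_length S _) (word_length S x) (word_length S _) (word_length T _) => a b c d.
rewrite !mulnDl; have := leq_mul (leqnn M) (ltn0Sn d); rewrite muln1.
move: (M * _)%N (K * _)%N (K' * _)%N; lia.
Qed.

End CoarseLength.

Theorem corollary4p41 (G H : groupType)
    (countable_G : countable [set: G]) (countable_H : countable [set: H])
    (phi : G -> H) (coarse_phi : coarse_equivalence phi) :
  (forall (R : comPzRingType) (W : lmodType R),
    [/\ homology_iso phi (all_functions W G) (all_functions W H),
        homology_iso phi (finite_valued W G) (finite_valued W H),
        cohomology_iso phi (finite_valued W G) (finite_valued W H)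
      & cohomology_iso phi (finitely_supported W G) (finitely_supported W H)])
  /\
  (forall (R : realType) (F : scalars R),
    F = real_scalars R \/ F = complex_scalars R ->
    [/\ forall (p : \bar R) (p_gt0 : (0 < p)%E),
          [/\ homology_iso phi (lp_space F G p_gt0) (lp_space F H p_gt0),
              cohomology_iso phi (lp_space F G p_gt0) (lp_space F H p_gt0),
              reduced_homology_iso phi (lp_space F G p_gt0) (lp_space F H p_gt0)
            & reduced_cohomology_iso phi (lp_space F G p_gt0) (lp_space F H p_gt0)],
        [/\ homology_iso phi (c0_space F G) (c0_space F H),
            cohomology_iso phi (c0_space F G) (c0_space F H),
            reduced_homology_iso phi (c0_space F G) (c0_space F H)
          & reduced_cohomology_iso phi (c0_space F G) (c0_space F H)]
      & forall (S : generating_set G) (T : generating_set H)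
          (s p : \bar R) (p_gt0 : (0 < p)%E), (-oo < s)%E -> (1 <= p)%E ->
          [/\ homology_iso phi (sobolev_space F S s p_gt0) (sobolev_space F T s p_gt0),
              cohomology_iso phi (sobolev_space F S s p_gt0) (sobolev_space F T s p_gt0),
              reduced_homology_iso phi
                (sobolev_space F S s p_gt0) (sobolev_space F T s p_gt0)
            & reduced_cohomology_iso phi
                (sobolev_space F S s p_gt0) (sobolev_space F T s p_gt0)]]).
Proof.
have [cphi [psi [cpsi psiphi phipsi]]] := coarse_phi.
split=> [R W|R F _].
  split.
  - by apply: (transfer_homology_iso cphi cpsi) => //; exact: all_functions_transfer.
  - by apply: (transfer_homology_iso cphi cpsi) => //; exact: finite_valued_transfer.
  - by apply: (transfer_cohomology_iso cphi cpsi) => //; exact: finite_valued_transfer.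
  - by apply: (transfer_cohomology_iso cphi cpsi) => //; exact: finitely_supported_transfer.
split=> [p p0||S T s p p0 _ _].
- split.
  + by apply: (transfer_homology_iso cphi cpsi) => //; exact: lp_transfer.
  + by apply: (transfer_cohomology_iso cphi cpsi) => //; exact: lp_transfer.
  + by apply: (transfer_reduced_homology_iso cphi cpsi) => //;
      first [exact: lp_transfer | exact: lp_transfer_bounded].
  + by apply: (transfer_reduced_cohomology_iso cphi cpsi) => //;
      first [exact: lp_transfer | exact: lp_transfer_bounded].
- split.
  + by apply: (transfer_homology_iso cphi cpsi) => //; exact: c0_transfer.
  + by apply: (transfer_cohomology_iso cphi cpsi) => //; exact: c0_transfer.
  + by apply: (transfer_reduced_homology_iso cphi cpsi) => //;
      first [exact: c0_transfer | exact: c0_transfer_bounded].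
  + by apply: (transfer_reduced_cohomology_iso cphi cpsi) => //;
      first [exact: c0_transfer | exact: c0_transfer_bounded].
(* Chains move values along [phi] and [psi], cochains along their converses, and the homotopies
   along equality; weighted norms need a length comparison for each. *)
have lphi := coarse_length_comparable S T cphi cpsi psiphi.
have lpsi := coarse_length_comparable T S cpsi cphi phipsi.
have lphi' := length_comparable_sym lphi; have lpsi' := length_comparable_sym lpsi.
have lS := length_comparable_eq S; have lT := length_comparable_eq T.
split.
- by apply: (transfer_homology_iso cphi cpsi) => //; exact: sobolev_transfer.
- by apply: (transfer_cohomology_iso cphi cpsi) => //; exact: sobolev_transfer.
- by apply: (transfer_reduced_homology_iso cphi cpsi) => //;
    first [exact: sobolev_transfer | exact: sobolev_transfer_bounded].
- by apply: (transfer_reduced_cohomology_iso cphi cpsi) => //;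
    first [exact: sobolev_transfer | exact: sobolev_transfer_bounded].
Qed.
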